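(* Let $d\ge 1$ be a fixed integer, and for each odd composite integer $n$ let $S$ (depending on $n$) be a fixed $d$-dimensional cyclic extension of $\mathbb{Z}/n\mathbb{Z}$ with Galois group generated by $\sigma$, with associated number $Gal(n)$ of bad witnesses for the Galois test. Then, as $x\to\infty$, $$\frac{1}{x}\sum_{\substack{n\le x\\ n \text{ odd composite}}} Gal(n) \le x^{d}L(x)^{-1+o(1)}.$$
   Context: For all large $x$, $L(x)=\exp\left(\frac{\log x\,\log\log\log x}{\log\log x}\right)$. For an odd integer $n\ge 3$ put $R=\mathbb{Z}/n\mathbb{Z}$. A $d$-dimensional cyclic extension $S$ of $R$ is a Galois extension of commutative rings $S/R$ with cyclic Galois group $\langle\sigma\rangle$ of order $d$ (i.e. $S^{\langle\sigma\rangle}=R$ and for every maximal ideal $\mathfrak{M}$ of $S$ and every $1\le i\le d-1$ there is $y\in S$ with $\sigma^i(y)-y\notin\mathfrak{M}$); $S$ is then free of rank $d$ over $R$. $Gal(n)$ denotes the number of $x\in S^\times$ satisfying $\sigma(x)=x^n$. Known description: for each prime $p\mid n$, the ring $\mathbf{L}_p=S/pS$ is isomorphic to a product of $m$ copies of $\mathbb{F}_{p^f}$ with $fm=d$, and there is an integer $z$ coprime to $f$ with $y^p=\sigma^{zm}(y)$ for all $y\in\mathbf{L}_p$; let $t\in\{1,\dots,f-1\}$ be the inverse of $z$ modulo $f$ (with $t=0$ if $f=1$). The integers $m,f,t$ depend on $p$ (and on $S$). Then $$Gal(n)=\prod_{p\mid n}\gcd(n^m-p^t,\,p^f-1),$$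 the product being over the distinct primes $p$ dividing $n$. *)

(* Defs.v *)
From HB Require Import structures.
From mathcomp Require Import all_boot all_order all_algebra.
From mathcomp Require Import finmap.
From mathcomp Require Import all_classical all_reals all_analysis.

Set Implicit Arguments.
Unset Strict Implicit.
Unset Printing Implicit Defensive.

Import Order.TTheory GRing.Theory Num.Theory.
Import numFieldNormedType.Exports.
Local Open Scope classical_set_scope.
Local Open Scope ring_scope.

(* [idealr_closed] already requires the ideal to be proper.  Classically, the
   boolean predicates [{pred S}] range over all subsets of [S]. *)
Definition maximal_ideal (S : comNzRingType) (M : {pred S}) : Prop :=
  idealr_closed M /\
  forall J : {pred S}, idealr_closed J -> {subset M <= J} -> {subset J <= M}.

(* The structure map of the [A]-algebra [S] is [a |-> a%:A]. *)
Record cyclic_extension (d : nat) (A : comNzRingType) (S : comUnitAlgType A)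
    (sigma : {lrmorphism S -> S}) : Prop := CyclicExtension {
  cyclic_ext_period : forall y : S, iter d sigma y = y;
  cyclic_ext_order : forall i : nat, (0 < i < d)%N ->
    exists y : S, iter i sigma y <> y;
  cyclic_ext_inj : injective (fun a : A => a%:A : S);
  cyclic_ext_fixed : forall y : S, sigma y = y <-> exists a : A, y = a%:A;
  cyclic_ext_galois : forall M : {pred S}, maximal_ideal M ->
    forall i : nat, (1 <= i <= d.-1)%N ->
    exists y : S, iter i sigma y - y \notin M }.

(* A cyclic extension of a finite ring is finitely generated as a module, hence
   finite, so that [fset_set] does not return its default value [fset0] on the
   sets counted below. *)
Definition Gal (A : comNzRingType) (S : comUnitAlgType A)
    (sigma : {lrmorphism S -> S}) (n : nat) : nat :=
  #|` fset_set [set y : S | y \is a GRing.unit /\ sigma y = y ^+ n] |%fset.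

Definition odd_composite (n : nat) : bool :=
  [&& odd n, (1 < n)%N & ~~ prime n].

Definition L (R : realType) (x : R) : R :=
  expR (ln x * ln (ln (ln x)) / ln (ln x)).

(* Main.v *)
(* For p | n choose a residue field of S of characteristic p; these separate the
   solutions x of sigma(x) = x^n.  The characteristic polynomial
   prod_i (T - sigma^i(x)) has coefficients in Z/n, so in a residue field either
   x lies in a field with p^r elements, r < d, or its d Frobenius conjugates are
   all distinct and x^(1+p+...+p^(d-1)) is the norm of x, an (n-1)-th root of
   unity in F_p.  Hence Gal(n) <= 4^omega(n) n^(d-1) F(n) with
   F(n) = prod_{p|n} gcd(n-1, p-1), and only the mean of F over composite
   integers matters, as for the Fermat test (Erdos and Pomerance).

   Let T = L(x) and D = x/T^2.  The n <= D, and those with a prime factor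
   exceeding T, contribute little.  Any other n has a divisor u with D < u <= DT;
   the numbers h_p = gcd(n-1, p-1), p | u, confine n to one class modulo
   u lcm(h_p), and summing over u and (h_p) by Rankin's method gives
   x^2/L(x)^(1-o(1)). *)
From HB Require Import structures.
Require Import Defs.
From mathcomp Require Import all_boot all_order all_algebra.
From mathcomp Require Import finmap.
From mathcomp Require Import all_classical all_reals all_analysis.
From mathcomp Require Import ring lra zify.

Set Implicit Arguments.
Unset Strict Implicit.
Unset Printing Implicit Defensive.

Import Order.TTheory GRing.Theory Num.Theory.
Import numFieldNormedType.Exports.
Local Open Scope classical_set_scope.
Local Open Scope ring_scope.

(** * Residue fields of a cyclic extension and the bound on [Gal] *)

(** The exponent [d] is [(d - 1) + 2 - 1]: [n^(d-1)] comes from the residue fields, [x^2 / L(x)] is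
    the size of the sum of [F], and the average divides by [x]. For a Carmichael number [F(n)] is
    the Euler function of [n], so a pointwise bound is useless and the average has to be exploited.

    Replacing [n] by a divisor [u] costs the factor [n / u], which asks for [u] near [x]; counting a
    class modulo [u lcm(h_p)] has an error [1] for every tuple [(h_p)], which asks for [u] well
    below [x]. The window from [x / T^2] to [x / T] keeps both losses, as well as the one from
    primes beyond [T], at [x^2 / T] up to small factors. In the main term the gain is [D^-(1-c)],
    and the price is a double exponential of the sum of [q^-c] over the primes [q] dividing
    [lcm(h_p)]. That sum stays below [log log x] for [1 - c] close to [log log log x / log log x],
    and [x^(1-c)] is then close to [L(x)]: this is where [L] comes from.

    Compositeness serves in the case of a large prime factor, since [F(p) = p - 1]. Each loss is
    kept in the form [L(x)^del] with [del] fixed, and [del] tends to [0] only at the very end. *)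

Section MaximalQuotient.
Local Open Scope quotient_scope.
Variables (S : comNzRingType) (I : idealr S).
Hypothesis maxI : forall u, u \notin (I : {pred S}) -> exists v, 1 - v * u \in (I : {pred S}).

Local Notation Q := {ideal_quot I}.

(** The second clause is the convention [0^-1 = 0] required by the field structure; both clauses sit
    under one existential so that a single choice yields a total inverse. *)
Let quot_inv_ex (x : Q) : exists y : Q, (x != 0 -> y * x = 1) /\ (x = 0 -> y = 0).
Proof.
elim/quotW: x => x; have [->|x0] := eqVneq (\pi_Q x) 0.
  by exists 0; split.
have /maxI[v hv] : x \notin (I : {pred S}).
  by apply: contra x0 => xI; rewrite -(rmorph0 \pi_Q) -Quotient.idealrBE subr0.
exists (\pi_Q v); split=> // [_|/eqP]; last by rewrite (negPf x0).
rewrite -rmorphM -(rmorph1 \pi_Q); apply/eqP.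
by rewrite eq_sym -Quotient.idealrBE.
Qed.

Let quot_inv (x : Q) : Q := projT1 (cid (quot_inv_ex x)).

Let quot_mulVf (x : Q) : x != 0 -> quot_inv x * x = 1.
Proof. by rewrite /quot_inv; case: (cid _) => y [] /=. Qed.

Let quot_inv0 : quot_inv 0 = 0.
Proof. by rewrite /quot_inv; case: (cid _) => y [] /= _ ->. Qed.

HB.instance Definition _ := GRing.ComNzRing_isField.Build Q quot_mulVf quot_inv0.

Lemma maximal_quotient_field :
  exists (K : fieldType) (f : {rmorphism S -> K}), forall x, x \in (I : {pred S}) -> f x = 0.
Proof.
exists Q, (\pi_Q : {rmorphism S -> Q}) => x xI.
by apply/eqP; rewrite -(rmorph0 \pi_Q) -Quotient.idealrBE subr0.
Qed.

End MaximalQuotient.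

(** The multiples of [a] form a proper ideal; Zorn's lemma gives a maximal one containing [a], and
    its quotient is the field. *)
Lemma nonunit_residue_field (S : comNzRingType) (a : S) :
  (forall s, s * a != 1) ->
  exists (K : fieldType) (f : {rmorphism S -> K}), f a = 0.
Proof.
move=> au.
pose ideal (A : set S) := [/\ A 0, ~ A 1, A a &
  forall s x y, A x -> A y -> A (s * x + y)].
have [F FP Ftot|A [PA Amax]] := @Zorn_bigcup S (fun A => A = set0 \/ ideal A).
  have [F0|/existsNP[A /not_implyP[FA A0]]] := pselect (forall A, F A -> A = set0).
    by left; rewrite -subset0 => x [A /F0 ->].
  have idF B : F B -> B !=set0 -> ideal B by move=> /FP [->|//] [].
  have [] : ideal A by apply: idF => //; apply/set0P/eqP.
  move=> A0' A1 Aa _; right; split.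
  - by exists A.
  - by move=> [B FB B1]; have [] : ideal B by apply: idF => //; exists 1.
  - by exists A.
  move=> s x y [B FB Bx] [C FC Cy].
  have [BC|CB] := Ftot _ _ FB FC.
    by exists C => //; have [_ _ _ h] : ideal C by [apply: idF => //; exists y];
       apply: h => //; exact: BC.
  by exists B => //; have [_ _ _ h] : ideal B by [apply: idF => //; exists x];
       apply: h => //; exact: CB.
have idA : ideal A.
  case: PA => // A0.
  have : ideal [set x | exists s, x = s * a].
    split => /=.
    - by exists 0; rewrite mul0r.
    - by move=> [s /eqP]; rewrite eq_sym (negPf (au s)).
    - by exists 1; rewrite mul1r.
    - by move=> s x y [u ->] [v ->]; exists (s * u + v); rewrite mulrDl mulrA.
  move=> idB; case: (Amax [set x | exists s, x = s * a]); last by right.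
  by rewrite A0; split; [move=> x []|move=> h; have /h : [set x | exists s, x = s * a] a by exists 1; rewrite mul1r].
have [A0 A1 Aa Ac] := idA.
pose P x := `[< A x >].
have AE x : (x \in P) = `[< A x >] by [].
have cl : idealr_closed P.
  split; rewrite ?AE; [exact/asboolP|exact/asboolPn|].
  by move=> s x y; rewrite !AE => /asboolP ? /asboolP ?; apply/asboolP/Ac.
pose I : idealr S := HB.pack P (GRing.isZmodClosed.Build _ _ (idealr_closedB cl)) (isProperIdeal.Build _ _ (idealr_closed_nontrivial cl)).
have [|K [f hf]] := @maximal_quotient_field S I; last first.
  by exists K, f; apply: hf; apply/asboolP.
move=> u; rewrite AE => /asboolPn Au.
(* [B] is the ideal generated by [A] and [u]. If it contains [1], then [u] is invertible modulo [A];
   otherwise it contradicts the maximality of [A]. *)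
pose B := [set x | exists v w, A w /\ x = w + v * u].
have [[v [w [Aw e]]]|B1] := pselect (B 1).
  by exists v; rewrite AE e addrK; apply/asboolP.
case: (Amax B).
  split; first by move=> x Ax; exists 0, x; rewrite mul0r addr0.
  by move=> /(_ u) h; apply/Au/h; exists 1, 0; rewrite mul1r add0r.
right; split => //.
- by exists 0, 0; rewrite mul0r addr0.
- by exists 0, a; rewrite mul0r addr0.
- move=> s x y [v1 [w1 [Aw1 ->]]] [v2 [w2 [Aw2 ->]]].
  exists (s * v1 + v2), (s * w1 + w2); split; first exact: Ac.
  by rewrite mulrDr mulrDl !mulrA addrACA.
Qed.

(** The maps together embed [X] in the product of their images. The targets [Y i] are unrelated and
    possibly infinite types, so a value is encoded by its index in the list of values taken, an
    ordinal below the common bound [m.+1]. *)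
Lemma card_le_prod_codom (X : finType) (k : nat) (Y : 'I_k -> eqType)
    (f : forall i, X -> Y i) :
  (forall x y, (forall i, f i x = f i y) -> x = y) ->
  (#|X| <= \prod_(i < k) size (undup (codom (f i))))%N.
Proof.
move=> finj.
have fx i x : f i x \in undup (codom (f i)) by rewrite mem_undup codom_f.
pose m := (\max_(i < k) size (undup (codom (f i))))%N.
pose g i x := index (f i x) (undup (codom (f i))).
have gm i x : (g i x < m.+1)%N.
  by rewrite ltnS (leq_trans _ (leq_bigmax i)) // ltnW // index_mem.
pose h x := [ffun i => Ordinal (gm i x)].
have hinj : injective h.
  move=> x y /ffunP e; apply: finj => i.
  have := congr1 val (e i); rewrite /h !ffunE /= /g => e'.
  exact: (index_inj (f i x) (fx i x) (fx i y) e').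
pose F i := [pred j : 'I_m.+1 | (j < size (undup (codom (f i))))%N].
have <- : #|family F| = (\prod_(i < k) size (undup (codom (f i))))%N.
  rewrite card_family foldrE big_map big_enum /=; apply: eq_bigr => i _.
  rewrite -sum1_card (eq_bigl (fun j : 'I_m.+1 => (j < size (undup (codom (f i))))%N)) //.
  rewrite -(big_ord_widen _ (fun=> 1%N)); first by rewrite sum1_card card_ord.
  by rewrite ltnW // ltnS leq_bigmax.
rewrite -(card_imset _ hinj); apply: subset_leq_card; apply/fintype.subsetP => _ /imsetP[x _ ->].
by apply/familyP => i; rewrite inE ffunE /= index_mem.
Qed.

Lemma size_roots_le (K : idomainType) (ps : seq {poly K}) (vs : seq K) :
  uniq vs -> all (fun p => p != 0) ps ->
  {in vs, forall v, has (fun p => root p v) ps} ->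
  (size vs <= \sum_(p <- ps) (size p).-1)%N.
Proof.
move=> vu ps0 vr.
have p0 : \prod_(p <- ps) p != 0 by rewrite prodf_seq_neq0; apply: sub_all ps0.
have -> : (\sum_(p <- ps) (size p).-1 = (size (\prod_(p <- ps) p)%R).-1)%N.
  elim: ps ps0 {vr p0} => [|p ps IH] /=; first by rewrite !big_nil size_poly1.
  move=> /andP[p0 ps0]; rewrite !big_cons IH // size_mul //; last first.
    by rewrite prodf_seq_neq0; apply: sub_all ps0.
  have : \prod_(j <- ps) j != 0 by rewrite prodf_seq_neq0; apply: sub_all ps0.
  by move: p0; rewrite -!size_poly_gt0; case: size => // a; case: size => // b; rewrite addnS.
rewrite -ltnS prednK ?size_poly_gt0 //; apply: max_poly_roots => //.
apply/allP => v /vr /hasP[p pps pv].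
by rewrite (big_rem p) //= rootM pv.
Qed.

Lemma expr_gcdn_eq1 (R : pzSemiRingType) (x : R) m n :
  (0 < m)%N -> x ^+ m = 1 -> x ^+ n = 1 -> x ^+ gcdn m n = 1.
Proof.
move=> m0 xm xn; have [a _ /dvdnP[q e]] := Bezoutl n m0.
by have := congr1 (fun k => x ^+ k) e; rewrite exprD mulnC exprM xn expr1n mulr1 mulnC exprM xm expr1n.
Qed.

(* Over F_p a monic polynomial is permuted by Frobenius, so a root z with d
   distinct conjugates z^(p^j) exhausts the roots of one of degree d. *)
Lemma frobenius_orbit_or_norm (K : fieldType) p d (a : nat -> K) :
  p \in [pchar K] -> (0 < d)%N ->
  (forall j, (\prod_(i < d) ('X - (a i)%:P))`_j ^+ p = (\prod_(i < d) ('X - (a i)%:P))`_j) ->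
  (exists2 r : 'I_d, (0 < r)%N & a 0%N ^+ (p ^ r) = a 0%N) \/
  \prod_(i < d) a i = a 0%N ^+ (\sum_(j < d) p ^ j).
Proof.
move=> pK d0; set f := \prod_(i < d) _ => fp.
have p_gt0 : (0 < p)%N by apply: prime_gt0; exact: pcharf_prime pK.
have fF : map_poly (pFrobenius_aut pK) f = f.
  by apply/polyP => j; rewrite coef_map /= pFrobenius_autE fp.
have rootF z : root f z -> root f (z ^+ p).
  move=> /eqP fz; rewrite /root -{1}fF -(pFrobenius_autE pK) horner_map fz.
  by rewrite rmorph0.
have root_z j : root f (a 0%N ^+ (p ^ j)).
  elim: j => [|j /rootF]; last by rewrite -exprM expnSr.
  case: d @f d0 fp {fF rootF} => // d f _ fp; rewrite expn0 expr1 /f.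
  by rewrite big_ord_recl rootM /= root_XsubC eqxx.
have powE j x : x ^+ (p ^ j) = iter j (pFrobenius_aut pK) x.
  elim: j => [|j IH]; first by rewrite expr1.
  by rewrite expnSr exprM IH iterS pFrobenius_autE.
have [/exists_inP[r r0 /eqP er]|] :=
  boolP [exists r : 'I_d, (0 < r)%N && (a 0%N ^+ (p ^ r) == a 0%N)].
  by left; exists r.
rewrite negb_exists => /forallP noR; right.
have iinj k x y : iter k (pFrobenius_aut pK) x = iter k (pFrobenius_aut pK) y -> x = y.
  by elim: k => //= k IH /(fmorph_inj (pFrobenius_aut pK)).
have inj : {in iota 0 d &, injective (fun j => a 0%N ^+ (p ^ j))}.
  have wl i j : (i <= j < d)%N -> a 0%N ^+ (p ^ i) = a 0%N ^+ (p ^ j) -> i = j.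
    move=> /andP[ij jd]; rewrite !powE -{1}(subnKC ij) iterD => e.
    have {}e : a 0%N = iter (j - i) (pFrobenius_aut pK) (a 0%N) by exact: iinj e.
    have jid : (j - i < d)%N by rewrite (leq_ltn_trans (leq_subr _ _)).
    have := noR (Ordinal jid); rewrite /= powE -e eqxx andbT -leqNgt leqn0 subn_eq0 => ji.
    by apply/eqP; rewrite eqn_leq ij.
  move=> i j; rewrite !mem_iota !add0n /= => id jd e.
  have [ij|ij] := leqP i j; first by apply: wl => //; rewrite ij.
  by apply/esym/wl => //; rewrite ltnW.
pose rs := [seq a 0%N ^+ (p ^ j) | j <- iota 0 d].
have rsu : uniq rs by rewrite map_inj_in_uniq ?iota_uniq.
have fE : f = \prod_(z <- rs) ('X - z%:P).
  have fm : f \is monic by apply: monic_prod => i _; rewrite monicXsubC.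
  rewrite {1}(@all_roots_prod_XsubC _ f rs).
  - by rewrite (monicP fm) scale1r.
  - by rewrite size_prod_XsubC /index_enum -enumT size_enum_ord size_map size_iota.
  - by apply/allP => _ /mapP[j _ ->].
  - by rewrite uniq_rootsE.
have sgn (b : nat -> K) : (\prod_(i < d) ('X - (b i)%:P)).[0] = (-1) ^+ d * \prod_(i < d) b i.
  rewrite horner_prod; under eq_bigr do rewrite !hornerE -mulN1r.
  by rewrite big_split /= prodr_const card_ord.
rewrite expr_sum; apply: (mulfI (x := (-1) ^+ d)).
  by rewrite expf_eq0 oppr_eq0 oner_eq0 andbF.
by rewrite -sgn -(sgn (fun j => a 0%N ^+ (p ^ j))) -/f fE big_map -[X in iota 0 X]subn0 big_mkord.
Qed.

Lemma prod_primes_dvd (s : seq nat) m :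
  uniq s -> all prime s -> all (fun p => p %| m)%N s -> (\prod_(p <- s) p %| m)%N.
Proof.
elim: s => [|p s IH] /=; first by rewrite big_nil dvd1n.
move=> /andP[ps us] /andP[pp sp] /andP[pm sm].
rewrite big_cons Gauss_dvd ?pm ?IH // prime_coprime // Euclid_dvd_prod //.
rewrite big_has; apply/hasPn => q qs; apply: contra ps.
by rewrite dvdn_prime2 ?(allP sp q qs) // => /eqP ->.
Qed.

Lemma dvdn_exp_primes n m : (0 < n)%N ->
  {in primes n, forall p, p %| m}%N -> (n %| m ^ n)%N.
Proof.
move=> n0 nm; apply/dvdn_partP => // p pn.
rewrite p_part (@dvdn_trans (p ^ n)) ?dvdn_exp2r ?nm //.
by rewrite dvdn_exp2l // ltnW // ltn_logl.
Qed.

(** * Characteristic polynomials and the units with [sigma y = y ^+ n] *)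

Section CharacteristicPolynomial.
Variables (n d : nat) (S : comUnitRingType) (sigma : {rmorphism S -> S}).
Hypotheses (n_gt1 : (1 < n)%N) (d_gt0 : (0 < d)%N).
Hypothesis modulus_eq0 : n%:R = 0 :> S.
Hypothesis modulus_dvd : forall k, k%:R = 0 :> S -> (n %| k)%N.
Hypothesis sigma_per : forall y : S, iter d sigma y = y.
Hypothesis fixed_natr : forall y : S, sigma y = y -> exists k : nat, y = k%:R.

(** Were [p] invertible in [S], cancelling it in [n = 0] would give [n / p = 0], against
    characteristic exactly [n]. *)
Lemma prime_residue_field p : prime p -> (p %| n)%N ->
  exists (K : fieldType) (f : {rmorphism S -> K}), f p%:R = 0.
Proof.
move=> pp pn; apply: nonunit_residue_field => s; apply/eqP => sp.
have n0 := ltnW n_gt1.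
have /modulus_dvd : (n %/ p)%:R = 0 :> S.
  have e : s * p%:R * (n %/ p)%:R = 0.
    by rewrite -mulrA -natrM mulnC divnK // modulus_eq0 mulr0.
  by rewrite -e sp mul1r.
by rewrite gtnNdvd // ?ltn_Pdiv ?prime_gt1 // divn_gt0 ?prime_gt0 // dvdn_leq.
Qed.

Definition conj_poly (x : S) : {poly S} := \prod_(i < d) ('X - (iter i sigma x)%:P).

Lemma prod_conj_shift (R : comPzSemiRingType) (F : S -> R) x :
  \prod_(i < d) F (iter i.+1 sigma x) = \prod_(i < d) F (iter i sigma x).
Proof.
have := sigma_per x; case: d => [|m] per; first by rewrite !big_ord0.
by rewrite big_ord_recr big_ord_recl per mulrC.
Qed.

(** [sigma] permutes the factors cyclically, so it fixes the coefficients. In a residue field of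
    characteristic [p] they therefore land in the prime field, as [frobenius_orbit_or_norm]
    requires. *)
Lemma conj_poly_coef x j : exists k : nat, (conj_poly x)`_j = k%:R.
Proof.
apply: fixed_natr; rewrite -coef_map; congr (_`_j).
pose F (y : S) : {poly S} := 'X - y%:P.
rewrite rmorph_prod (eq_bigr (fun i : 'I_d => F (iter i.+1 sigma x))).
  by rewrite (prod_conj_shift F).
by move=> i _; exact: map_polyXsubC.
Qed.

Section ResidueField.
Variables (p : nat) (K : fieldType) (f : {rmorphism S -> K}).
Hypotheses (p_pr : prime p) (fp : f p%:R = 0).

Lemma residue_pchar : p \in [pchar K].
Proof. by rewrite inE p_pr -(rmorph_nat f) fp eqxx. Qed.

Lemma natr_exp_pchar k : (k%:R : K) ^+ p = k%:R.
Proof. by rewrite -(pFrobenius_autE residue_pchar) rmorph_nat. Qed.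

(** The norm [N] is fixed by [sigma], hence an integer, and its nonzero image satisfies
    [N^(p-1) = 1]. Since [sigma x = x ^+ n], raising to the power [n] only shifts the conjugates, so
    [N ^+ n = N] and [N^(n-1) = 1]. The two exponents combine into their gcd. *)
Lemma residue_norm_or_orbit (x : S) :
  x \is a GRing.unit -> sigma x = x ^+ n ->
  (exists2 r : 'I_d, (0 < r)%N & f x ^+ (p ^ r) = f x) \/
  f x ^+ ((\sum_(j < d) p ^ j) * gcdn n.-1 p.-1) = 1.
Proof.
move=> xu sx.
have [] := @frobenius_orbit_or_norm K p d (fun i => f (iter i sigma x)) residue_pchar d_gt0.
- move=> j.
  have -> : \prod_(i < d) ('X - (f (iter i sigma x))%:P) = map_poly f (conj_poly x).
    by rewrite rmorph_prod; apply: eq_bigr => i _; exact/esym/map_polyXsubC.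
  have [k hk] := conj_poly_coef x j.
  by rewrite coef_map /= hk rmorph_nat natr_exp_pchar.
- by left.
move=> /= e; right; rewrite exprM -e -rmorph_prod.
set N := \prod_(i < d) iter i sigma x.
have iu i : iter i sigma x \is a GRing.unit.
  by elim: i => //= i IH; rewrite rmorph_unit.
have Nu : N \is a GRing.unit by apply: rpred_prod => i _.
have sN : sigma N = N.
  by rewrite rmorph_prod; exact: (prod_conj_shift id x).
have Nn : N ^+ n = N.
  rewrite -[RHS](prod_conj_shift id) /N -prodrXl; apply: eq_bigr => i _.
  by elim: (val i) => //= k IH; rewrite -IH rmorphXn /= -IH.
have fN0 : f N != 0 by rewrite -unitfE rmorph_unit.
apply: expr_gcdn_eq1; first by rewrite -subn1 subn_gt0.
  apply: (mulfI fN0); rewrite mulr1 -exprS prednK ?(ltnW n_gt1) //.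
  by rewrite -rmorphXn Nn.
have [k hk] := fixed_natr sN.
apply: (mulfI fN0); rewrite mulr1 -exprS prednK ?prime_gt0 //.
by rewrite hk rmorph_nat natr_exp_pchar.
Qed.

(** The roots of [X^(E g) - 1] account for one copy of [E g]; the polynomials [X^(p^r) - X] with
    [0 < r < d] have total degree at most [E], which the second copy covers. *)
Lemma residue_card_le (vs : seq S) :
  (forall v, v \in vs -> v \is a GRing.unit /\ sigma v = v ^+ n) ->
  (size (undup (map f vs)) <= 2 * ((\sum_(j < d) p ^ j) * gcdn n.-1 p.-1))%N.
Proof.
move=> vsP; set E := (\sum_(j < d) p ^ j)%N; set g := gcdn _ _.
have g0 : (0 < g)%N by rewrite gcdn_gt0 -!subn1 !subn_gt0 n_gt1.
have E0 : (0 < E)%N.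
  by rewrite /E; case: d d_gt0 => // m _; rewrite big_ord_recl /= expn0.
have p_gt1 := prime_gt1 p_pr.
pose ps : seq {poly K} := ('X^(E * g) - 1) ::
  [seq 'X^(p ^ val r) - 'X | r <- enum 'I_d & (0 < val r)%N].
have sX k : (0 < k)%N -> size ('X^k - 1 : {poly K}) = k.+1.
  by move=> k0; rewrite size_XnsubC.
have sXX k : (1 < k)%N -> size ('X^k - 'X : {poly K}) = k.+1.
  by move=> k0; rewrite size_polyDl ?size_polyXn // size_polyN size_polyX ltnS.
have pr1 r : (0 < r)%N -> (1 < p ^ r)%N by move=> r0; rewrite -(expn0 p) ltn_exp2l.
apply: leq_trans (@size_roots_le K ps _ (undup_uniq _) _ _) _.
- rewrite /= -size_poly_gt0 sX ?muln_gt0 ?E0 //=; apply/allP => _ /mapP[r + ->].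
  by rewrite mem_filter => /andP[r0 _]; rewrite -size_poly_gt0 sXX ?pr1.
- move=> w; rewrite mem_undup => /mapP[v /vsP[vu sv] ->].
  have [[r r0 er]|e] := residue_norm_or_orbit vu sv.
    rewrite /=; apply/orP; right; apply/hasP; exists ('X^(p ^ val r) - 'X).
      by apply/mapP; exists r => //; rewrite mem_filter r0 mem_enum.
    by rewrite /root !hornerE er subrr.
  by rewrite /= /root !hornerE e subrr eqxx.
rewrite big_cons sX ?muln_gt0 ?E0 //= mul2n -addnn leq_add2l.
rewrite big_map big_filter big_enum_cond /=.
rewrite (@leq_trans E) ?leq_pmulr //.
rewrite [leqRHS](bigID (fun r : 'I_d => (0 < r)%N)) /=.
apply: leq_trans (leq_addr _ _); apply: leq_sum => r r0.
by rewrite sXX ?pr1.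
Qed.

End ResidueField.

Lemma nilpotent_expr_fixed (y : S) k :
  y ^+ k = 0 -> (1 + y) ^+ (n ^ d) = 1 + y -> y = 0.
Proof.
move=> yk ye.
have ex M : exists w, (1 + y) ^+ M = 1 + y *+ M + y ^+ 2 * w.
  elim: M => [|M [w IH]]; first by exists 0; rewrite mulr0n mulr0 !addr0.
  exists (w + w * y + 1 *+ M); rewrite exprS IH mulrS -[y *+ M]mulr_natr.
  by rewrite -[1 *+ M]/(M%:R); ring.
have [w] := ex (n ^ d)%N; rewrite ye -mulr_natr natrX modulus_eq0 expr0n.
rewrite gtn_eqF // mulr0 addr0 => /addrI e.
have {}e j : y = y ^+ j.+1 * w ^+ j.
  elim: j => [|j IH]; first by rewrite mulr1.
  transitivity (y * (y ^+ j.+1 * w ^+ j) * w); first by rewrite -IH {1}e expr2.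
  by rewrite !exprS; ring.
by rewrite (e k) exprS yk mulr0 mul0r.
Qed.

(* All conjugates of y = w - 1 vanish in the residue fields, so y^d lies in
   rad(n) S and y is nilpotent; then (1 + y)^(n^d) = 1 + y and n = 0 give
   y = y^2 v, whence y = 0. *)
Lemma residue_trivial (w : S) :
  sigma w = w ^+ n ->
  (forall p, prime p -> (p %| n)%N -> exists (K : fieldType) (f : {rmorphism S -> K}),
     f p%:R = 0 /\ f w = 1) -> w = 1.
Proof.
move=> sw hw; pose y := w - 1.
have wi i : iter i sigma w = w ^+ (n ^ i).
  by elim: i => //= i ->; rewrite rmorphXn /= sw -exprM expnS.
have wy : w = 1 + y by rewrite addrC subrK.
have wd : w ^+ (n ^ d) = w by rewrite -wi sigma_per.
suff [k yk] : exists k, y ^+ k = 0.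
  by rewrite wy (nilpotent_expr_fixed yk) ?addr0 // -wy.
pose r := (\prod_(p <- primes n) p)%N.
have n0 : (0 < n)%N by exact: ltnW.
have nr : (n %| r ^ n)%N.
  by apply: dvdn_exp_primes => // p pn; rewrite /r (big_rem p) //= dvdn_mulr.
have sc : size (conj_poly y) = d.+1.
  by rewrite size_prod_XsubC /index_enum -enumT size_enum_ord.
have cj (j : 'I_d) : exists k : S, (conj_poly y)`_j = r%:R * k.
  have [k hk] := conj_poly_coef y j.
  suff /dvdnP[q e] : (r %| k)%N by exists q%:R; rewrite hk e natrM mulrC.
  apply: prod_primes_dvd; rewrite ?primes_uniq //.
    by apply/allP => p; rewrite mem_primes => /andP[].
  apply/allP => p; rewrite mem_primes => /and3P[pp _ pn].
  have [K [f [fp fw]]] := hw p pp pn.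
  rewrite (dvdn_pcharf (residue_pchar pp fp)) -(rmorph_nat f) -hk -coef_map /=.
  suff -> : map_poly f (conj_poly y) = 'X^d by rewrite coefXn ltn_eqF.
  rewrite rmorph_prod -[in RHS](card_ord d) -prodr_const; apply: eq_bigr => i _.
  rewrite [LHS]map_polyXsubC -[iter i sigma y]/(iter i sigma (w - 1)).
  have -> : iter i sigma (w - 1) = iter i sigma w - 1.
    by elim: (val i) => //= l ->; rewrite rmorphB rmorph1.
  by rewrite rmorphB wi rmorphXn fw expr1n rmorph1 subrr subr0.
have [c hc] := choice cj.
have : (conj_poly y).[y] = 0.
  rewrite /conj_poly; case: d d_gt0 => // m _.
  by rewrite big_ord_recl /= hornerM !hornerE subrr mul0r.
rewrite horner_coef sc big_ord_recr /=.
have -> : (conj_poly y)`_d = 1.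
  have /monicP : conj_poly y \is monic by apply: monic_prod => i _; rewrite monicXsubC.
  by rewrite lead_coefE sc.
under eq_bigr do rewrite hc -mulrA.
rewrite -mulr_sumr mul1r => /eqP; rewrite addrC addr_eq0 => /eqP yd.
exists (d * n)%N; rewrite exprM yd exprNn exprMn -natrX.
by have /dvdnP[q ->] := nr; rewrite natrM modulus_eq0 mulr0 mul0r mulr0.
Qed.

(** Solutions are closed under quotients. Two of them with equal images in one residue field for
    each prime divisor of [n] have a quotient to which [residue_trivial] applies, so these fields
    separate solutions. *)
Lemma card_power_eigenvectors_le :
  (#|` fset_set [set y : S | y \is a GRing.unit /\ sigma y = y ^+ n]%classic |
   <= \prod_(p <- primes n) (2 * ((\sum_(j < d) p ^ j) * gcdn n.-1 p.-1)))%N.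
Proof.
set A := mkset _.
(* On an infinite set [fset_set] takes its default value, the empty set, and the bound is
   trivial. *)
have [Afin|Ainf] := pselect (finite_set A); last first.
  by rewrite /fset_set; case: pselect => // _; rewrite cardfs0.
have AP (x : fset_set A) : val x \is a GRing.unit /\ sigma (val x) = val x ^+ n.
  by have := valP x; rewrite in_fset_set // inE.
pose k := size (primes n); pose q (i : 'I_k) := nth 0%N (primes n) i.
have qP i : prime (q i) /\ (q i %| n)%N.
  have : q i \in primes n by apply: mem_nth.
  by rewrite mem_primes => /and3P[].
have /choice[K hK] (i : 'I_k) : exists K : fieldType, exists f : {rmorphism S -> K}, f (q i)%:R = 0.
  by have [? ?] := qP i; apply: prime_residue_field.
pose f i := projT1 (cid (hK i)).
have fq i : f i (q i)%:R = 0 := projT2 (cid (hK i)).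
have := @card_le_prod_codom (fset_set A) k K (fun i x => f i (val x)).
rewrite cardfE => /(_ _)/leq_trans; apply.
  move=> x y exy; apply/val_inj.
  have [xu sx] := AP x; have [yu sy] := AP y.
  suff xy1 : val x / val y = 1 by rewrite -[LHS](divrK yu) xy1 mul1r.
  apply: residue_trivial => //; first by rewrite rmorphM rmorphV //= sx sy exprMn exprVn.
  move=> p pp pn.
  have pi : p \in primes n by rewrite mem_primes pp pn (ltnW n_gt1).
  have ik : (index p (primes n) < k)%N by rewrite index_mem.
  have := exy (Ordinal ik); have := fq (Ordinal ik); set i := Ordinal ik.
  have -> : q i = p by rewrite /q /= nth_index.
  move=> fp e; exists (K i), (f i); split => //.
  by rewrite rmorphM /= e -rmorphM divrr // rmorph1.
rewrite (big_nth 0%N) big_mkord; apply: leq_prod => i _.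
rewrite codomE (map_comp (f i) val).
apply: residue_card_le => //; first by case: (qP i).
by move=> _ /mapP[x _ ->].
Qed.

End CharacteristicPolynomial.

Lemma Gal_le (n d : nat) (S : comUnitAlgType 'Z_n) (sigma : {lrmorphism S -> S}) :
  (1 < n)%N -> (0 < d)%N -> cyclic_extension d sigma ->
  (Gal sigma n <= \prod_(p <- primes n) (2 * ((\sum_(j < d) p ^ j) * gcdn n.-1 p.-1)))%N.
Proof.
move=> n1 d0 ext.
have algE (a : 'Z_n) : a%:A = (a : nat)%:R :> S by rewrite -{1}(natr_Zp a) scaler_nat.
apply: (@card_power_eigenvectors_le n d S sigma) => //.
- by rewrite -scaler_nat pchar_Zp // scale0r.
- move=> k; rewrite -scaler_nat -(scale0r 1) => /(cyclic_ext_inj ext)/(congr1 val).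
  by rewrite /= val_Zp_nat // => /eqP.
- exact: cyclic_ext_period ext.
by move=> y /(cyclic_ext_fixed ext)[a ->]; exists (a : nat); rewrite algE.
Qed.

(** * Sums over integers by their prime factors *)

Lemma ler_sum_inj (R : numDomainType) (T T' : eqType) (s : seq T) (s' : seq T')
    (h : T -> T') (f : T -> R) (f' : T' -> R) :
  uniq s -> {in s &, injective h} -> {in s, forall x, h x \in s'} ->
  {in s, forall x, f x <= f' (h x)} -> {in s', forall y, 0 <= f' y} ->
  \sum_(x <- s) f x <= \sum_(y <- s') f' y.
Proof.
elim: s s' => [|x s IH] s' /=.
  by move=> _ _ _ _ f0; rewrite big_nil big_seq sumr_ge0.
move=> /andP[xs us] hinj hs' ff' f0.
have hx : h x \in s' by apply: hs'; rewrite mem_head.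
rewrite big_cons (big_rem _ hx) /= lerD ?ff' ?mem_head //.
apply: IH => //.
- by move=> y z ys zs; apply: hinj; rewrite inE ?ys ?zs orbT.
- move=> y ys; have hy : h y \in s' by apply: hs'; rewrite inE ys orbT.
  have : h y != h x.
    apply: contraNneq xs => e; rewrite -(hinj y x) ?mem_head ?inE ?ys ?orbT //.
  by move=> yx; move: hy; rewrite (perm_mem (perm_to_rem hx)) inE (negPf yx).
- by move=> y ys; apply: ff'; rewrite inE ys orbT.
- by move=> y /mem_rem; apply: f0.
Qed.

Lemma ler_sum_nat_inj (R : numDomainType) (M N : nat) (P Q : pred nat)
    (h : nat -> nat) (f f' : nat -> R) :
  (forall x, (1 <= x <= M)%N -> P x -> (1 <= h x <= N)%N && Q (h x)) ->
  (forall x y, P x -> P y -> (1 <= x <= M)%N -> (1 <= y <= M)%N -> h x = h y -> x = y) ->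
  (forall x, (1 <= x <= M)%N -> P x -> f x <= f' (h x)) ->
  (forall y, Q y -> 0 <= f' y) ->
  \sum_(1 <= x < M.+1 | P x) f x <= \sum_(1 <= y < N.+1 | Q y) f' y.
Proof.
move=> hN hinj ff' f0; rewrite -[leLHS]big_filter -[leRHS]big_filter.
have mf X (A : pred nat) x : (x \in [seq i <- index_iota 1 X.+1 | A i]) = (1 <= x <= X)%N && A x.
  by rewrite mem_filter mem_index_iota ltnS andbC.
apply: (ler_sum_inj (h := h)).
- by rewrite filter_uniq // iota_uniq.
- by move=> x y; rewrite !mf => /andP[xM Px] /andP[yM Py]; apply: hinj.
- by move=> x; rewrite !mf => /andP[xM Px]; apply: hN.
- by move=> x; rewrite mf => /andP[xM Px]; apply: ff'.
- by move=> y; rewrite mf => /andP[_ Qy]; apply: f0.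
Qed.

Lemma sum_multiples_le (R : numDomainType) (N y : nat) (P : pred nat) (f : nat -> R) :
  (0 < y)%N -> (forall u, 0 <= f u) ->
  \sum_(1 <= u < N.+1 | P u && (y %| u)%N) f u <=
  \sum_(1 <= w < N.+1 | P (y * w)%N) f (y * w)%N.
Proof.
move=> y0 f0; apply: (@ler_sum_nat_inj _ _ _ _ _ (fun u => u %/ y)%N) => //.
- move=> u /andP[u1 uN] /andP[Pu yu]; rewrite mulnC divnK // Pu andbT.
  rewrite divn_gt0 // dvdn_leq //=; exact: leq_trans (leq_div _ _) uN.
- move=> u v /andP[_ yu] /andP[_ yv] _ _ e.
  by rewrite -(divnK yu) e divnK.
- by move=> u _ /andP[_ yu]; rewrite mulnC divnK.
Qed.

(** * An Euler product bound for truncated sums *)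

Section EulerProduct.
Variables (R : realType) (r b : nat -> R) (N : nat).
Hypothesis r_mul : forall u v, r (u * v)%N = r u * r v.
Hypothesis r_ge0 : forall u, 0 <= r u.
Hypothesis r1 : r 1%N = 1.
Hypothesis r_lt1 : forall p, prime p -> r p < 1.
Hypothesis b_ge0 : forall p, 0 <= b p.

Let g u := r u * \prod_(p <- primes u) b p.
Let smooth y u := all (fun q => q <= y)%N (primes u).
Let A y := \sum_(1 <= u < N.+1 | smooth y u) g u.

Let g_ge0 u : 0 <= g u.
Proof. by rewrite mulr_ge0 // prodr_ge0. Qed.

Let g_mul p u : prime p -> (0 < u)%N ->
  g (p * u) = r p * (if (p %| u)%N then 1 else b p) * g u.
Proof.
move=> pp u0; rewrite /g r_mul -!mulrA; congr (_ * _).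
rewrite [RHS]mulrCA; congr (_ * _).
have p0 := prime_gt0 pp.
have pu : primes (p * u) =i p :: primes u.
  by move=> q; rewrite primesM // (primes_prime pp) !inE.
have [pdu|pndu] := boolP (p %| u)%N.
  rewrite mul1r; apply: perm_big; apply: uniq_perm; rewrite ?primes_uniq //.
  move=> q; rewrite pu inE; case: eqVneq => //= ->.
  by rewrite mem_primes pp u0.
rewrite -[RHS](big_cons _ _ p (primes u) xpredT); apply: perm_big; apply: uniq_perm => //=.
  by rewrite primes_uniq.
by rewrite primes_uniq mem_primes (negPf pndu) !andbF.
Qed.

Let smooth_mul y p u : prime p -> (0 < u)%N ->
  smooth y (p * u) = (p <= y)%N && smooth y u.
Proof.
move=> pp u0; rewrite /smooth -[RHS]/(all _ (p :: primes u)).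
by apply: eq_all_r => q; rewrite primesM // ?prime_gt0 // (primes_prime pp) !inE.
Qed.

Let smoothS y u : (0 < u)%N -> smooth y.+1 u ->
  smooth y u || (prime y.+1 && (y.+1 %| u)%N).
Proof.
move=> u0 /allP su; have [//|] := boolP (smooth y u).
move=> /allPn[q qu]; rewrite -ltnNge => yq.
have := su q qu; rewrite leq_eqVlt ltnS [(q <= y)%N]leqNgt yq orbF => /eqP e.
by move: qu; rewrite e mem_primes => /and3P[-> _ ->].
Qed.

Let smooth_ndvd y u : (0 < u)%N -> prime y.+1 -> smooth y u -> (y.+1 %| u)%N = false.
Proof.
move=> u0 py /allP su; apply/negP => yu.
by have := su y.+1; rewrite mem_primes py u0 yu ltnn => /(_ isT).
Qed.

Let A0 : A 0 <= 1.
Proof.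
rewrite /A; case: (posnP N) => [->|N0]; first by rewrite big_geq.
have g1 : g 1%N = 1 by rewrite /g r1 mul1r big_nil.
rewrite big_ltn_cond //= g1.
rewrite big_nat_cond big1 ?addr0 // => u /andP[/andP[u1 _] /allP su].
have := su (pdiv u); rewrite mem_primes pdiv_prime // pdiv_dvd (ltnW u1) /=.
by rewrite leqNgt pdiv_gt0 => /(_ isT).
Qed.

Let A_nonprime y : ~~ prime y.+1 -> A y.+1 = A y.
Proof.
move=> py; rewrite /A big_nat_cond [RHS]big_nat_cond; apply: eq_bigl => u.
case: (boolP (1 <= u < N.+1)%N) => //= /andP[u1 _]; apply/idP/idP.
  by move=> /(smoothS u1); rewrite (negPf py) orbF.
by apply: sub_all => q /leqW.
Qed.

(* With B the part of A y.+1 carried by the multiples of p = y.+1, dividing by p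
   gives B <= r p * (b p * A y + B). *)
Let A_prime y (p := y.+1) : prime p -> A p <= A y * (1 + b p * (r p / (1 - r p))).
Proof.
move=> pp.
pose B := \sum_(1 <= u < N.+1 | smooth p u && (p %| u)%N) g u.
have split (h : nat -> R) :
    \sum_(1 <= u < N.+1 | smooth p u) h u =
    \sum_(1 <= u < N.+1 | smooth p u && (p %| u)%N) h u + \sum_(1 <= u < N.+1 | smooth y u) h u.
  rewrite (bigID (fun u => (p %| u)%N)) /=; congr (_ + _).
  rewrite big_nat_cond [RHS]big_nat_cond; apply: eq_bigl => u.
  case: (boolP (1 <= u < N.+1)%N) => //= /andP[u1 _]; apply/andP/idP.
    by move=> [/(smoothS u1)]; rewrite pp /= => /orP[//|->].
  move=> su; rewrite smooth_ndvd //; split=> //.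
  by apply: sub_all su => q /leqW.
have AE : A p = B + A y by rewrite /A split.
have hB : B <= r p * (b p * A y + B).
  rewrite /B; apply: le_trans (sum_multiples_le _ _ (prime_gt0 pp) g_ge0) _.
  rewrite -/p.
  rewrite (@le_trans _ _ (\sum_(1 <= w < N.+1 | smooth p w) (r p * (if (p %| w)%N then 1 else b p) * g w))) //.
    rewrite big_nat_cond [leRHS]big_nat_cond le_eqVlt; apply/orP; left; apply/eqP.
    apply: eq_big => [u|u /andP[/andP[u1 _] _]]; last by rewrite g_mul.
    by case: (boolP (1 <= u < N.+1)%N) => //= /andP[u1 _]; rewrite smooth_mul // leqnn.
  rewrite split // mulrDr [leRHS]addrC lerD //.
    rewrite mulr_sumr; apply: ler_sum => u /andP[_ ->]; by rewrite mulr1.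
  rewrite /A !mulr_sumr big_nat_cond [leRHS]big_nat_cond; apply: ler_sum => u /andP[/andP[u1 _] su].
  by rewrite smooth_ndvd // mulrA.
rewrite AE mulrDr mulr1 addrC lerD2l.
have rp := r_lt1 pp; have r10 : 0 < 1 - r p by rewrite subr_gt0.
rewrite !mulrA ler_pdivlMr // mulrBr mulr1 lerBlDr -[_ * r p]mulrC.
by apply: le_trans hB _; rewrite mulrDr [B * _]mulrC (mulrC (A y)).
Qed.

(** The local factor at [p] is [1 + b p * (r p + r p ^+ 2 + ...)], as [b p] enters once whatever the
    multiplicity; it is at most the exponential of its second term. The induction is on the bound
    [y] for the prime factors, with [u <= N] throughout, so no infinite product occurs. *)
Lemma euler_product_le :
  \sum_(1 <= u < N.+1) g u <=
  expR (\sum_(1 <= p < N.+1 | prime p) b p * (r p / (1 - r p))).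
Proof.
have -> : \sum_(1 <= u < N.+1) g u = A N.
  rewrite /A big_nat [RHS]big_nat_cond; apply: eq_bigl => u.
  case: (boolP (1 <= u < N.+1)%N) => //= /andP[u1 uN]; apply/esym/allP => q.
  by rewrite mem_primes => /and3P[_ u0 /(dvdn_leq u0) qu]; rewrite -ltnS (leq_ltn_trans qu uN).
have : forall y, A y <= expR (\sum_(1 <= p < y.+1 | prime p) b p * (r p / (1 - r p))).
  elim=> [|y IH]; first by rewrite big_geq // expR0 A0.
  rewrite big_mkcond big_nat_recr //= -big_mkcond.
  case: ifP => [py|/negbT py]; last by rewrite addr0 A_nonprime.
  apply: le_trans (A_prime py) _; rewrite expRD ler_pM //.
  - by rewrite sumr_ge0.
  - by rewrite addr_ge0 // mulr_ge0 // divr_ge0 // subr_ge0 ltW // r_lt1.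
  - exact: expR_ge1Dx.
exact.
Qed.

End EulerProduct.

(** * Power sums and weights built from the divisors of [p - 1] *)

Section PowerSums.
Variable R : realType.
Implicit Types (s c y : R) (u N W n : nat).

Lemma powR_expln (a x : R) : 0 < a -> a `^ x = expR (x * ln a).
Proof. by move=> a0; rewrite /powR gt_eqF. Qed.

Lemma powRN_antitone s (u v : R) : 0 <= s -> 0 < u -> u <= v -> v `^ (- s) <= u `^ (- s).
Proof.
move=> s0 u0 uv; have v0 := lt_le_trans u0 uv.
rewrite !powR_expln // ler_expR !mulNr lerN2 ler_wpM2l // ler_ln //.
Qed.

Lemma invSn_le_ln N : (0 < N)%N -> (N.+1%:R : R)^-1 <= ln (N.+1%:R : R) - ln (N%:R : R).
Proof.
move=> N0; have NR : 0 < (N%:R : R) by rewrite ltr0n.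
have SR : 0 < (N.+1%:R : R) by rewrite ltr0n.
have q0 : 0 < (N%:R : R) / N.+1%:R by rewrite divr_gt0.
have e : (N%:R : R) / N.+1%:R = 1 + (- N.+1%:R^-1).
  by rewrite -{1}(addrK 1 N%:R) natr1 mulrBl divff ?mul1r // gt_eqF.
have := @le_ln1Dx R (- N.+1%:R^-1).
rewrite -e ln_div ?posrE // => /(_ _); rewrite -lerN2 opprB opprK; apply.
by rewrite ltrN2 invf_lt1 // ltr1n ltnS.
Qed.

Lemma harmonic_le N : \sum_(1 <= h < N.+1) (h%:R : R)^-1 <= 1 + ln (N.+1%:R : R).
Proof.
suff h : \sum_(1 <= h < N.+2) (h%:R : R)^-1 <= 1 + ln (N.+1%:R : R).
  apply: le_trans h; rewrite [leRHS]big_nat_recr //= lerDl invr_ge0 ler0n //.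
elim: N => [|N IH]; first by rewrite big_nat1 invr1 ln1 addr0.
rewrite big_nat_recr //=; apply: le_trans (lerD IH (lexx _)) _.
have := @invSn_le_ln N.+1 isT.
by move: (ln _) (ln _) (_^-1) => a b c; lra.
Qed.

Lemma zeta_partial_le s N : 1 < s ->
  \sum_(1 <= j < N.+1) (j%:R : R) `^ (- s) <= 1 + (s - 1)^-1.
Proof.
move=> s1; have e0 : 0 < s - 1 by rewrite subr_gt0.
(* The right-hand side is [1] plus the integral of [t^-s] from [1] to [N + 1]; in this sharper form
   the bound passes through the induction. *)
suff h : \sum_(1 <= j < N.+2) (j%:R : R) `^ (- s) <=
    1 + (s - 1)^-1 * (1 - (N.+1%:R : R) `^ (- (s - 1))).
  rewrite (@le_trans _ _ (\sum_(1 <= j < N.+2) (j%:R : R) `^ (- s))) //.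
    by rewrite [leRHS]big_nat_recr //= lerDl powR_ge0.
  apply: le_trans h _; rewrite lerD2l ler_piMr ?invr_ge0 ?(ltW e0) //.
elim: N => [|N IH].
  by rewrite big_nat1 !powR1 subrr mulr0 addr0.
rewrite big_nat_recr //=; apply: le_trans (lerD IH (lexx _)) _.
set a := (N.+2%:R : R); set b := (N.+1%:R : R).
have a0 : 0 < a by rewrite ltr0n. have b0 : 0 < b by rewrite ltr0n.
have as_ : a `^ (- s) = a^-1 * a `^ (- (s - 1)).
  rewrite -(powR_inv1 (ltW a0)) -powRD; last by rewrite (gt_eqF a0) implybT.
  by congr powR; lra.
have hb : a `^ (- (s - 1)) * (1 + (s - 1) * a^-1) <= b `^ (- (s - 1)).
  rewrite !powR_expln //.
  have -> : - (s - 1) * ln b = - (s - 1) * ln a + (s - 1) * (ln a - ln b) by ring.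
  rewrite expRD ler_wpM2l ?expR_ge0 //; apply: le_trans (expR_ge1Dx _).
  by rewrite lerD2l ler_wpM2l ?(ltW e0) //; exact: invSn_le_ln.
rewrite as_; move: hb; set A := a `^ _; set B := b `^ _ => hb.
have : a^-1 * A <= (s - 1)^-1 * (B - A).
  rewrite ler_pdivlMl //; move: hb; set v := a^-1; nra.
have -> : 1 + (s - 1)^-1 * (1 - A) = 1 + (s - 1)^-1 * (1 - B) + (s - 1)^-1 * (B - A) by ring.
by rewrite lerD2l.
Qed.

Lemma powR_prime_lt1 s p : 0 < s -> prime p -> (p%:R : R) `^ (- s) < 1.
Proof.
move=> s0 pp; have p1 := prime_gt1 pp.
rewrite powR_expln ?ltr0n ?prime_gt0 // expR_lt1 mulNr oppr_lt0.
by apply: mulr_gt0 => //; apply: ln_gt0; rewrite ltr1n.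
Qed.

Lemma powR_euler_le s (b : nat -> R) N : 0 < s -> (forall p, 0 <= b p) ->
  \sum_(1 <= u < N.+1) (u%:R : R) `^ (- s) * \prod_(p <- primes u) b p <=
  expR (\sum_(1 <= p < N.+1 | prime p)
     b p * ((p%:R : R) `^ (- s) / (1 - (p%:R : R) `^ (- s)))).
Proof.
move=> s0 b0; apply: (@euler_product_le R (fun u => (u%:R : R) `^ (- s)) b N) => //.
- by move=> u v; rewrite natrM powRM.
- exact: (congr1 (fun f => f (- s)) (powR1 R)).
- by move=> p; exact: powR_prime_lt1.
Qed.

(** In the exponent of the Euler product, [p^-s <= 1/2] turns [p^-s / (1 - p^-s)] into at most
    [2 * (p - 1)^-s]. After exchanging the sums, [p - 1 = h m] with [m] arbitrary: primality is
    dropped, [h * h^-s] remains, and the sum over [m] is at most [1 + (s - 1)^-1]. *)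
Lemma sum_divisor_weights_le (H : pred nat) s N : 1 < s ->
  \sum_(1 <= u < N.+1) (u%:R : R) `^ (- s) *
     \prod_(p <- primes u) (\sum_(1 <= h < N.+1 | (h %| p.-1)%N && H h) (h%:R : R)) <=
  expR (2 * (1 + (s - 1)^-1) * \sum_(1 <= h < N.+1 | H h) (h%:R : R) `^ (- (s - 1))).
Proof.
move=> s1; have s0 : 0 < s by lra.
pose b p := \sum_(1 <= h < N.+1 | (h %| p.-1)%N && H h) (h%:R : R).
have b0 p : 0 <= b p by rewrite sumr_ge0.
apply: le_trans (powR_euler_le N s0 b0) _; rewrite ler_expR.
pose G u := (u%:R : R) `^ (- s).
have G0 u : 0 <= G u by exact: powR_ge0.
apply: (@le_trans _ _ (\sum_(1 <= p < N.+1 | prime p) 2 * \sum_(1 <= h < N.+1 | (h %| p.-1)%N && H h) (h%:R : R) * G p.-1)).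
  apply: ler_sum => p pp; have p1 := prime_gt1 pp.
  have Gp : G p <= 2^-1.
    rewrite /G; apply: le_trans (powRN_antitone (ltW s0) _ _) _; last 1 first.
    - rewrite -(powR_inv1 (_ : 0 <= 2)) //; apply: (ler_powR (a := 2)); first by lra.
      by rewrite lerN2 ltW.
    - by [].
    - by rewrite ler_nat.
  rewrite -mulr_suml [leRHS]mulrCA -/(b p); apply: ler_wpM2l => //.
  have -> : (p%:R : R) `^ (- s) = G p by [].
  rewrite ler_pdivrMr; last by lra.
  have GG : G p <= G p.-1.
    apply: powRN_antitone; rewrite ?ltW //.
      by rewrite ltr0n -subn1 subn_gt0.
    by rewrite ltr_nat prednK // prime_gt0.
  move: Gp GG; have := G0 p; set x := G p; set z := G p.-1 => x0 xh xz.
  by nra.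
rewrite -mulr_sumr -!mulrA ler_wpM2l //.
have -> : \sum_(1 <= p < N.+1 | prime p) \sum_(1 <= h < N.+1 | (h %| p.-1)%N && H h) (h%:R : R) * G p.-1
   = \sum_(1 <= h < N.+1 | H h) (h%:R : R) * \sum_(1 <= p < N.+1 | prime p && (h %| p.-1)%N) G p.-1.
  rewrite [LHS](exchange_big_dep H) /=; last by move=> p h _ /andP[].
  apply: eq_bigr => h Hh; rewrite mulr_sumr; apply: eq_bigl => p.
  by rewrite Hh andbT.
rewrite mulr_sumr big_nat_cond [leRHS]big_nat_cond.
apply: ler_sum => h /andP[/andP[h1 hN] Hh].
have hR : 0 < (h%:R : R) by rewrite ltr0n.
have h1s : (h%:R : R) * G h = (h%:R : R) `^ (- (s - 1)).
  rewrite -{1}(powRr1 (ltW hR)) /G -powRD; last by rewrite (gt_eqF hR) implybT.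
  by congr powR; lra.
rewrite [leRHS]mulrC -h1s -mulrA ler_wpM2l ?ler0n //.
apply: (@le_trans _ _ (\sum_(1 <= m < N.+1 | true && (h %| m)%N) G m)).
  apply: (@ler_sum_nat_inj _ _ _ _ _ predn) => //.
  - move=> p pN /andP[pp ->]; rewrite andbT; have := prime_gt1 pp; lia.
  - move=> p q /andP[pp _] /andP[qq _] _ _ e.
    by rewrite -(prednK (prime_gt0 pp)) e prednK ?prime_gt0.
apply: le_trans (sum_multiples_le _ _ h1 G0) _.
under eq_bigr do rewrite /G natrM powRM // -/(G h).
by rewrite -mulr_sumr ler_wpM2l // zeta_partial_le.
Qed.

(** Divisors of [W] are relaxed to integers all of whose primes divide [W], which have an Euler
    product. The factor [4] bounds [1 / (1 - q^-c)], because [q^-c <= 2^(-1/2) <= 3/4]. *)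
Lemma sum_divisors_powR_le c N W : 2^-1 <= c -> (0 < W)%N ->
  \sum_(1 <= h < N.+1 | (h %| W)%N) (h%:R : R) `^ (- c) <=
  expR (4 * \sum_(q <- primes W) (q%:R : R) `^ (- c)).
Proof.
move=> c2 W0; have c0 : 0 < c by lra.
pose b p := ((p %| W)%N : nat)%:R : R.
have b0 p : 0 <= b p by rewrite ler0n.
apply: (@le_trans _ _ (\sum_(1 <= u < N.+1) (u%:R : R) `^ (- c) * \prod_(p <- primes u) b p)).
  rewrite big_mkcond; apply: ler_sum => u _; case: ifP => uW; last first.
    by rewrite mulr_ge0 ?powR_ge0 // prodr_ge0.
  rewrite big_seq big1 ?mulr1 // => p; rewrite mem_primes => /and3P[_ _ pu].
  by rewrite /b (dvdn_trans pu uW).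
apply: le_trans (powR_euler_le N c0 b0) _; rewrite ler_expR mulr_sumr.
rewrite -[leLHS]big_filter.
apply: (@le_trans _ _ (\sum_(p <- [seq p <- [seq i <- index_iota 1 N.+1 | prime i] | (p %| W)%N]) 4 * (p%:R : R) `^ (- c))).
  rewrite [leRHS]big_filter big_mkcond /= [leRHS]big_mkcond /= big_seq [leRHS]big_seq.
  apply: ler_sum => p; rewrite mem_filter => /andP[pp _].
  rewrite /b; case: ifP => _; last by rewrite mul0r.
  rewrite mul1r; set x := _ `^ _.
  have x0 : 0 <= x by exact: powR_ge0.
  suff xh : x <= 3 / 4 by rewrite ler_pdivrMr; nra.
  have : x <= (2 : R) `^ (- 2^-1).
    apply: le_trans (powRN_antitone (ltW c0) _ (_ : 2 <= _)) _; rewrite ?ler_nat ?prime_gt1 //.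
    by apply: (ler_powR (a := 2)); [lra|rewrite lerN2].
  have : ((2 : R) `^ (- 2^-1)) ^+ 2 = 2^-1.
    rewrite -powR_mulrn ?powR_ge0 // -powRrM -[RHS](powR_inv1 (_ : 0 <= 2)) //.
    by congr powR; field.
  have := powR_ge0 (2 : R) (- 2^-1).
  set t := _ `^ _ => t0 t2 xt.
  by apply: le_trans xt _; rewrite -(@ler_pXn2r _ 2) ?nnegrE // ?t2; lra.
apply: (ler_sum_inj (h := id)) => //.
- by rewrite !filter_uniq // iota_uniq.
- by move=> p; rewrite !mem_filter => /and3P[pW pp _]; rewrite mem_primes pp W0.
Qed.

End PowerSums.

(** * Chebyshev's bound and sums over prime divisors *)

Lemma prime_dvd_fact q M : prime q -> (q %| M`!)%N -> (q <= M)%N.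
Proof.
move=> qp; elim: M => [|M IH].
  by rewrite fact0 dvdn1 => /eqP q1; rewrite q1 in qp.
by rewrite factS Euclid_dvdM // => /orP[/dvdn_leq ->//|/IH/leqW].
Qed.

Lemma central_bin_le M : ('C(M, M./2) <= 2 ^ M)%N.
Proof.
have -> : (2 ^ M = \sum_(i < M.+1) 'C(M, i))%N.
  rewrite -[2%N]/(1 + 1)%N expnDn; apply: eq_bigr => i _.
  by rewrite !exp1n !muln1.
have h : (M./2 < M.+1)%N by rewrite ltnS; lia.
by rewrite (bigD1 (Ordinal h)) //= leq_addr.
Qed.

Lemma prime_dvd_central_bin q M : prime q -> (M < q <= M.*2)%N -> (q %| 'C(M.*2, M))%N.
Proof.
move=> qp /andP[Mq qM].
have MM : (M <= M.*2)%N by lia.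
have := bin_fact MM.
have -> : (M.*2 - M = M)%N by lia.
move=> e.
have : (q %| 'C(M.*2, M) * (M`! * M`!))%N by rewrite e dvdn_fact // qM prime_gt0.
rewrite !Euclid_dvdM //; case/or3P => //; move/(prime_dvd_fact qp); lia.
Qed.

Lemma expn_size_le_prod m (s : seq nat) :
  all (leq m) s -> (m ^ size s <= \prod_(q <- s) q)%N.
Proof.
elim: s => [|q s IH] /=; first by rewrite big_nil.
by move=> /andP[mq ms]; rewrite big_cons expnS leq_mul ?IH.
Qed.

(** Chebyshev's argument: the primes in this dyadic interval all divide the central binomial
    coefficient of [2 ^ J.+1], which is at most [2 ^ (2 ^ J.+1)], and each exceeds [2 ^ J]. *)
Lemma dyadic_prime_count J :
  (J * size [seq q <- index_iota (2 ^ J).+1 (2 ^ J.+1).+1 | prime q] <= 2 ^ J.+1)%N.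
Proof.
set s := seq.filter _ _.
have sP q : q \in s -> prime q /\ (2 ^ J < q <= 2 ^ J.+1)%N.
  by rewrite mem_filter mem_index_iota ltnS => /andP[].
rewrite -(@leq_exp2l 2) // expnM.
have e : ((2 ^ J).*2 = 2 ^ J.+1)%N by rewrite expnS mul2n.
have h1 : ((2 ^ J) ^ size s <= \prod_(q <- s) q)%N.
  apply: expn_size_le_prod; apply/allP => q /sP[_ /andP[h _]]; exact: ltnW.
apply: leq_trans h1 _.
apply: (@leq_trans 'C(2 ^ J.+1, 2 ^ J)); last first.
  by have := central_bin_le (2 ^ J.+1); rewrite -{2}e doubleK.
apply: dvdn_leq; first by rewrite bin_gt0 leq_exp2l.
apply: prod_primes_dvd; first by rewrite filter_uniq // iota_uniq.
  by apply/allP => q /sP[].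
by apply/allP => q /sP[qp]; rewrite -e; apply: prime_dvd_central_bin.
Qed.

Section RealBounds.
Variable R : realType.
Implicit Types (c y : R) (N W n : nat).

Lemma dyadic_prime_inv_le J : (0 < J)%N ->
  \sum_((2 ^ J).+1 <= q < (2 ^ J.+1).+1 | prime q) (q%:R : R)^-1 <= 2 / J%:R.
Proof.
move=> J0; rewrite -big_filter; have := dyadic_prime_count J.
set s := seq.filter _ _ => hs.
have p0 : 0 < ((2 ^ J)%N%:R : R) by rewrite ltr0n expn_gt0.
apply: (@le_trans _ _ (\sum_(q <- s) ((2 ^ J)%N%:R : R)^-1)).
  rewrite big_seq [leRHS]big_seq; apply: ler_sum => q.
  rewrite mem_filter mem_index_iota => /andP[_ /andP[h _]].
  have q0 : 0 < (q%:R : R) by rewrite ltr0n (leq_ltn_trans _ h).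
  by rewrite lef_pV2 ?posrE // ler_nat ltnW.
rewrite big_const_seq count_predT iter_addr_0 -[leLHS]mulr_natl ler_pdivrMr //.
rewrite mulrAC ler_pdivlMr ?ltr0n // -[2]/(2%N%:R) -!natrM ler_nat mulnC.
by rewrite -expnS.
Qed.

Lemma sum_prime_inv_pow2_le J :
  \sum_(1 <= q < (2 ^ J.+1).+1 | prime q) (q%:R : R)^-1 <=
  2^-1 + 2 * \sum_(1 <= j < J.+1) (j%:R : R)^-1.
Proof.
elim: J => [|J IH].
  rewrite [X in 2 * X]big_geq // mulr0 addr0 expn1 big_mkcond.
  by rewrite big_nat_recl //= big_nat1 /= add0r.
rewrite (big_cat_nat (n := (2 ^ J.+1).+1)) //=; last by rewrite ltnS leq_exp2l.
rewrite [\sum_(1 <= j < J.+2) _]big_nat_recr //= mulrDr addrA lerD //.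
exact: dyadic_prime_inv_le.
Qed.

(** An upper bound of Mertens type. The dyadic block of index [j] contributes at most [2 / j], and
    [ln 2 >= 1/2] bounds the number of blocks by [2 * ln y]; [5 / 2] is [1 / 2] for the prime [2]
    plus twice the [1] of [harmonic_le]. *)
Lemma sum_prime_inv_le y N : 1 <= y ->
  \sum_(1 <= q < N.+1 | prime q && (q%:R <= y)) (q%:R : R)^-1 <=
  5 / 2 + 2 * ln (1 + 2 * ln y).
Proof.
move=> y1; have y0 : 0 < y by lra.
have ln2 : 2^-1 <= ln (2 : R).
  by have := @invSn_le_ln R 1 isT; rewrite ln1 subr0.
have ln2p : 0 < ln (2 : R) by lra.
have lny : 0 <= ln y by rewrite ln_ge0.
pose J := Num.truncn (ln y / ln 2).
have /andP[J1 J2] : J%:R <= ln y / ln 2 < J.+1%:R.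
  by apply: truncn_itv; rewrite divr_ge0 // ltW.
have yJ : y <= (2 ^ J.+1)%N%:R.
  rewrite -ler_ln ?posrE ?ltr0n ?expn_gt0 // natrX lnXn // -[leRHS]mulr_natl.
  by rewrite -ler_pdivrMr // ltW.
apply: (@le_trans _ _ (\sum_(1 <= q < (2 ^ J.+1).+1 | prime q) (q%:R : R)^-1)).
  apply: (@ler_sum_nat_inj _ _ _ _ _ id) => //.
  - move=> q /andP[q1 _] /andP[qp qy]; rewrite qp q1 andbT /=.
    by rewrite -(ler_nat R) (le_trans qy).
apply: le_trans (sum_prime_inv_pow2_le J) _.
have := harmonic_le R J.
suff : ln (J.+1%:R : R) <= ln (1 + 2 * ln y).
  clear; move: (\sum_(_ <= _ < _) _) (ln J.+1%:R) (ln (1 + _)) => a b c; lra.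
clear yJ.
rewrite ler_ln ?posrE ?ltr0n //; last by lra.
rewrite -natr1 addrC lerD2l; apply: le_trans J1 _.
rewrite ler_pdivrMr //; move: lny ln2; clear; move: (ln y) (ln 2) => a b; nra.
Qed.

Lemma count_large_primes y W : 1 < y -> (0 < W)%N ->
  (size [seq q <- primes W | y < q%:R])%:R * ln y <= ln (W%:R : R).
Proof.
move=> y1 W0; have y0 : 0 < y by lra.
set s := seq.filter _ _.
have : (\prod_(q <- s) q <= W)%N.
  apply: dvdn_leq => //; apply: prod_primes_dvd; first by rewrite filter_uniq // primes_uniq.
    by apply/allP => q; rewrite mem_filter mem_primes => /and4P[].
  by apply/allP => q; rewrite mem_filter mem_primes => /and4P[].
rewrite -(ler_nat R) natr_prod => h.
have : y ^+ size s <= \prod_(q <- s) (q%:R : R).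
  have : all (fun q : nat => y < q%:R) s by apply: filter_all.
  elim: s {h} => [|q s IH] /=; first by rewrite big_nil.
  move=> /andP[yq ys]; rewrite big_cons exprS ler_pM ?exprn_ge0 ?IH ?ltW //.
move=> h2; have {h2}h := le_trans h2 h.
by rewrite mulr_natl -lnXn // ler_ln ?posrE ?exprn_gt0 ?ltr0n.
Qed.

(** Up to [y], [q^-c <= y^(1-c) / q] and the reciprocals are summed over all primes; beyond [y], [W]
    has at most [ln W / ln y] prime divisors, each contributing at most [y^-c]. *)
Lemma sum_primes_powR_le c y W : 0 <= c <= 1 -> 1 < y -> (0 < W)%N ->
  \sum_(q <- primes W) (q%:R : R) `^ (- c) <=
  y `^ (1 - c) * (5 / 2 + 2 * ln (1 + 2 * ln y)) + ln (W%:R : R) / ln y * y `^ (- c).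
Proof.
move=> /andP[c0 c1] y1 W0; have y0 : 0 < y by lra.
have lny : 0 < ln y by rewrite ln_gt0.
rewrite (bigID (fun q : nat => y < q%:R)) /= addrC lerD //; last first.
  rewrite -big_filter; have := count_large_primes y1 W0.
  have : all (fun q : nat => y < q%:R) [seq q <- primes W | y < q%:R] by apply: filter_all.
  set s := seq.filter _ _ => /allP sy hs.
  apply: (@le_trans _ _ (\sum_(q <- s) y `^ (- c))).
    rewrite big_seq [leRHS]big_seq; apply: ler_sum => q /sy yq.
    by apply: powRN_antitone => //; apply: ltW.
  rewrite big_const_seq count_predT iter_addr_0 -[leLHS]mulr_natl ler_wpM2r ?powR_ge0 //.
  by rewrite ler_pdivlMr.
apply: (@le_trans _ _ (y `^ (1 - c) * \sum_(1 <= q < W.+1 | prime q && (q%:R <= y)) (q%:R : R)^-1)); last first.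
  by rewrite ler_wpM2l ?powR_ge0 // sum_prime_inv_le // ltW.
rewrite mulr_sumr -[leLHS]big_filter -[leRHS]big_filter.
apply: (ler_sum_inj (h := id)) => //.
- by rewrite filter_uniq // primes_uniq.
- move=> q; rewrite !mem_filter mem_primes -leNgt mem_index_iota => /and4P[qy qp _ qW].
  by rewrite qy qp prime_gt0 //= ltnS dvdn_leq.
- move=> q; rewrite mem_filter mem_primes -leNgt => /and4P[qy qp _ _].
  have q0 : 0 < (q%:R : R) by rewrite ltr0n prime_gt0.
  have -> : (q%:R : R) `^ (- c) = q%:R `^ (1 - c) * q%:R^-1.
    rewrite -(powR_inv1 (ltW q0)) -powRD; last by rewrite (gt_eqF q0) implybT.
    by congr powR; lra.
  rewrite ler_wpM2r ?invr_ge0 ?ler0n //; apply: ge0_ler_powR; rewrite ?nnegrE ?ler0n //; lra.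
- by move=> q _; rewrite mulr_ge0 ?powR_ge0 // invr_ge0.
Qed.

Lemma size_primes_le y n : 1 < y -> (0 < n)%N ->
  (size (primes n))%:R <= y + ln (n%:R : R) / ln y.
Proof.
move=> y1 n0; have lny : 0 < ln y by rewrite ln_gt0.
rewrite -(count_predC (fun q : nat => y < q%:R)) natrD addrC lerD //; last first.
  by rewrite ler_pdivlMr // -size_filter; apply: count_large_primes.
rewrite -size_filter.
have /andP[t1 t2] : (Num.truncn y)%:R <= y < (Num.truncn y).+1%:R by apply: truncn_itv; lra.
apply: le_trans t1; rewrite ler_nat -(size_iota 1 (Num.truncn y)).
apply: uniq_leq_size; first by rewrite filter_uniq // primes_uniq.
move=> q; rewrite mem_filter mem_primes /= -leNgt mem_iota => /and4P[qy qp _ _].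
by rewrite prime_gt0 //= add1n -(ltr_nat R) (le_lt_trans qy).
Qed.

End RealBounds.

(** * Counting composite integers by their Fermat weight *)

(* For odd n, [fermat_weight n n] is the number of x mod n with x^(n-1) = 1. *)
Definition fermat_weight (n u : nat) : nat := (\prod_(p <- primes u) gcdn n.-1 p.-1)%N.

Definition composite (n : nat) : bool := (1 < n)%N && ~~ prime n.

(** A prime of [n] not dividing [u] contributes at most [p - 1], and the product of these primes
    divides [n / u]. *)
Lemma fermat_weight_split n u : (0 < n)%N -> (u %| n)%N ->
  (fermat_weight n n * u <= fermat_weight n u * n)%N.
Proof.
move=> n0 un; have u0 := dvdn_gt0 n0 un.
rewrite /fermat_weight (bigID (fun p => (p %| u)%N)) /= -mulnA.
have -> : (\prod_(p <- primes n | (p %| u)%N) gcdn n.-1 p.-1 =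
           \prod_(p <- primes u) gcdn n.-1 p.-1)%N.
  rewrite -big_filter; apply: perm_big; apply: uniq_perm.
  - by rewrite filter_uniq // primes_uniq.
  - exact: primes_uniq.
  move=> p; rewrite mem_filter !mem_primes n0 u0 /=.
  case: (boolP (p %| u)%N) => pu /=; last by rewrite andbF.
  by rewrite (dvdn_trans pu un).
rewrite leq_mul2l; apply/orP; right.
rewrite -[leqRHS](divnK un) leq_mul2r; apply/orP; right.
apply: (@leq_trans (\prod_(p <- primes n | ~~ (p %| u)) p)%N).
  rewrite big_seq_cond [leqRHS]big_seq_cond; apply: leq_prod => p /andP[pn _].
  move: pn; rewrite mem_primes => /andP[pp _].
  have p1 := prime_gt1 pp.
  by apply: (@leq_trans p.-1); [apply: dvdn_leq (dvdn_gcdr _ _) |]; lia.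
rewrite -big_filter; apply: dvdn_leq; first by rewrite divn_gt0 // dvdn_leq.
have sP p : p \in [seq p <- primes n | ~~ (p %| u)%N] -> [/\ prime p, (p %| n)%N & ~~ (p %| u)%N].
  by rewrite mem_filter mem_primes => /and4P[].
apply: prod_primes_dvd; first by rewrite filter_uniq // primes_uniq.
  by apply/allP => p /sP[].
apply/allP => p /sP[pp pn pu].
by have := pn; rewrite -{1}(divnK un) Euclid_dvdM // (negPf pu) orbF.
Qed.

Section Counting.
Variable R : realType.
Implicit Types (N n u w : nat).

Lemma sum1_le_nat_inj N M (P : pred nat) (h : nat -> nat) :
  (forall x, (1 <= x <= N)%N -> P x -> (1 <= h x <= M)%N) ->
  (forall x y, P x -> P y -> (1 <= x <= N)%N -> (1 <= y <= N)%N -> h x = h y -> x = y) ->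
  \sum_(1 <= n < N.+1 | P n) (1 : R) <= M%:R.
Proof.
move=> hM hinj; apply: (@le_trans _ _ (\sum_(1 <= y < M.+1) (1 : R))).
  apply: (@ler_sum_nat_inj _ _ _ _ _ h) => // x xN Px; by rewrite hM.
by rewrite sumr_const_nat subSS subn0.
Qed.

Lemma natr_divn_le N k : (N %/ k)%N%:R <= N%:R / k%:R :> R.
Proof.
have [->|k0] := posnP k; first by rewrite divn0 invr0 mulr0.
by rewrite ler_pdivlMr ?ltr0n // -natrM ler_nat leq_trunc_div.
Qed.

(** If any such [n] exists, [u] and [w] are coprime, so the [n] fill one class modulo [u * w]. For
    [w > N] nothing is counted; dropping the main term there lets the lcm of a tuple later serve as
    an index [W <= N]. *)
Lemma count_crt_le N u w : (0 < u)%N -> (0 < w)%N ->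
  \sum_(1 <= n < N.+1 | [&& (1 < n)%N, (u %| n)%N & (w %| n.-1)%N]) (1 : R) <=
  1 + (if (w <= N)%N then N%:R / (u%:R * w%:R) else 0).
Proof.
move=> u0 w0.
have [|wN] := leqP w N; last first.
  rewrite addr0 big_nat_cond big1 ?ler01 // => n /andP[/andP[n1 nN] /and3P[n2 _ wn]].
  have : (w <= n.-1)%N by apply: dvdn_leq wn; lia.
  by lia.
move=> wN; rewrite -natrM; apply: (@le_trans _ _ (1 + (N %/ (u * w))%N%:R)); last first.
  by rewrite lerD2l natr_divn_le.
rewrite nat1r; apply: (@sum1_le_nat_inj _ _ _ (fun n => (n %/ (u * w)).+1)%N).
  by move=> n /andP[_ nN] _ /=; rewrite ltnS leq_div2r.
move=> m n /and3P[m1 um wm] /and3P[n1 un wn] _ _ [e].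
have cuw : coprime u w.
  rewrite /coprime -dvdn1; have h1 := dvdn_trans (dvdn_gcdl u w) um.
  have h2 := dvdn_trans (dvdn_gcdr u w) wm.
  by rewrite -(dvdn_addr _ h2) addn1 prednK // ltnW.
rewrite (divn_eq m (u * w)) (divn_eq n (u * w)) e; congr (_ + _)%N.
apply/eqP; rewrite chinese_remainder //; apply/andP; split.
  by rewrite (eqP um) (eqP un).
have [em en] : (m = 1 + m.-1)%N /\ (n = 1 + n.-1)%N.
  by rewrite !add1n !prednK ?(ltnW m1) ?(ltnW n1).
by rewrite em en eqn_modDl (eqP wm) (eqP wn).
Qed.

(** There is no extra [1] here: [n = p v] with [v > 1] by compositeness, and [h] divides [v - 1], so
    [n = p * (h * j + 1)] with [j >= 1] and [p * h * j <= N]. *)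
Lemma count_prime_crt_le N p h : prime p -> (h %| p.-1)%N ->
  \sum_(1 <= n < N.+1 | [&& composite n, (p %| n)%N & (h %| n.-1)%N]) (1 : R) <=
  N%:R / (p%:R * h%:R).
Proof.
move=> pp hp; have p0 := prime_gt0 pp; have p1 := prime_gt1 pp.
have h0 : (0 < h)%N by apply: dvdn_gt0 hp; lia.
rewrite -natrM; apply: le_trans (natr_divn_le _ _).
have key n : [&& composite n, (p %| n)%N & (h %| n.-1)%N] ->
    exists2 j, (0 < j)%N & n = (p * (h * j).+1)%N.
  move=> /and3P[/andP[n1 npr] /dvdnP[v e] hn].
  have v1 : (1 < v)%N.
    case: v e => [|[|v]] // e; first by rewrite e in n1.
    by move: npr; rewrite e mul1n pp.
  have : (h %| v.-1)%N.
    have ev : n.-1 = (v * p.-1 + v.-1)%N.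
      have e2 : (v * p = v * p.-1 + v)%N by rewrite -{1}(prednK p0) mulnS addnC.
      by rewrite e e2 -subn1 -addnBA ?subn1 // ltnW.
    by move: hn; rewrite ev dvdn_addr // dvdn_mull.
  case/dvdnP => j ej; exists j.
    by case: j ej => //; move: v1; clear; case: v => [|[]].
  by rewrite e mulnC; congr (_ * _)%N; rewrite [(h * j)%N]mulnC -ej prednK ?(ltnW v1).
apply: (@sum1_le_nat_inj _ _ _ (fun n => (n %/ p).-1 %/ h)%N).
  move=> n /andP[_ nN] /key[j j0 e].
  rewrite e mulKn //= mulKn // j0 /= leq_divRL ?muln_gt0 ?p0 //.
  apply: leq_trans nN; by rewrite e mulnC -mulnA leq_mul2l leqnSn orbT.
move=> m n /key[i i0 ->] /key[j j0 ->] _ _.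
by rewrite /= !mulKn //= => ->.
Qed.

Section TupleExpansion.
Variables (N u : nat).
Hypotheses (u0 : (0 < u)%N) (uN : (u <= N)%N).

Let Pu : pred 'I_N.+1 := fun p => prime p && (p %| u)%N.
(** The tuples [(h_p)] indexed by the primes [p] dividing [u], as finite functions equal to [0]
    elsewhere, so that a product of sums over [h] can be expanded by distributivity. *)
Let fam (H : pred nat) := pfamily (ord0 : 'I_N.+1) Pu
  (fun p : 'I_N.+1 => [pred h : 'I_N.+1 | (h %| p.-1)%N && H h]).
Let wt (f : {ffun 'I_N.+1 -> 'I_N.+1}) : R := \prod_(p | Pu p) (f p : nat)%:R.

Let prod_primesE (S : Type) (idx : S) (op : Monoid.com_law idx) (G : nat -> S) :
  \big[op/idx]_(p <- primes u) G p = \big[op/idx]_(p | Pu p) G p.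
Proof.
rewrite -(big_mkord (fun p => prime p && (p %| u)%N)) -[RHS]big_filter.
apply: perm_big; apply: uniq_perm; rewrite ?filter_uniq ?primes_uniq ?iota_uniq //.
move=> p; rewrite mem_primes mem_filter mem_index_iota u0 /=.
case: (boolP (p %| u)%N) => pu; rewrite ?andbF // !andbT ltnS.
by rewrite (leq_trans (dvdn_leq u0 pu) uN) andbT.
Qed.

Let prod_divisor_sumE (H : pred nat) :
  \prod_(p <- primes u) (\sum_(1 <= h < N.+1 | (h %| p.-1)%N && H h) (h%:R : R)) =
  \sum_(f in fam H) wt f.
Proof.
rewrite prod_primesE.
transitivity (\prod_(p : 'I_N.+1 | Pu p) \sum_(h : 'I_N.+1 | (h %| p.-1)%N && H h) ((h : nat)%:R : R)); last first.
  by rewrite (big_distr_big_dep (ord0 : 'I_N.+1)).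
apply: eq_bigr => p _; rewrite -(big_mkord (fun h => (h %| p.-1)%N && H h) (fun h => h%:R)).
(* The ordinal [h = 0] lies outside the original range, but its term is [0]. *)
rewrite [RHS]big_mkcond big_nat_recl //= if_same add0r.
by rewrite big_add1 /= -big_mkcond.
Qed.

Let famP H f p : f \in fam H -> Pu p -> (f p %| p.-1)%N /\ H (f p).
Proof. by move=> /pfamilyP[_ h] /h; rewrite inE => /andP[]. Qed.

Let wlcm (f : {ffun 'I_N.+1 -> 'I_N.+1}) := (\big[lcmn/1]_(p | Pu p) (f p : nat))%N.

(** The tuple [h_p = gcd(n-1, p-1)] has weight exactly [fermat_weight n u] and an lcm dividing
    [n - 1]; by positivity all tuples with such an lcm may be summed. Exchanging sums and applying
    [count_crt_le] leaves an error [1] per tuple, the first term, and a main term with the inverse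
    of the lcm. The latter is at most the sum over every [W] for which all [h_p] divide [W], and
    this condition factors over the primes again. *)
Lemma sum_fermat_weight_le :
  \sum_(1 <= n < N.+1 | (1 < n)%N && (u %| n)%N) (fermat_weight n u)%:R <=
  \prod_(p <- primes u) (\sum_(1 <= h < N.+1 | (h %| p.-1)%N && true) (h%:R : R)) +
  N%:R / u%:R * \sum_(1 <= W < N.+1) (W%:R : R)^-1 *
     \prod_(p <- primes u) (\sum_(1 <= h < N.+1 | (h %| p.-1)%N && (h %| W)%N) (h%:R : R)).
Proof.
have wt0 f : 0 <= wt f by rewrite prodr_ge0.
have wlcm_gt0 f : f \in fam xpredT -> (0 < wlcm f)%N.
  move=> ff; rewrite /wlcm; apply: (big_ind (fun k => 0 < k)%N) => //.
    by move=> x y x0 y0; rewrite lcmn_gt0 x0.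
  move=> p pu; have [h _] := famP ff pu; apply: dvdn_gt0 h.
  by case/andP: pu => /prime_gt1; lia.
apply: (@le_trans _ _ (\sum_(1 <= n < N.+1 | (1 < n)%N && (u %| n)%N)
    \sum_(f in fam xpredT | (wlcm f %| n.-1)%N) wt f)).
  rewrite big_nat_cond [leRHS]big_nat_cond.
  apply: ler_sum => n /andP[/andP[_ nN] /andP[n1 un]].
  pose phi : {ffun 'I_N.+1 -> 'I_N.+1} :=
    [ffun p => if Pu p then inord (gcdn n.-1 p.-1) else ord0].
  have phiE p : Pu p -> phi p = gcdn n.-1 p.-1 :> nat.
    move=> pu; rewrite ffunE pu inordK // ltnS.
    apply: (@leq_trans n.-1); last by lia.
    by apply: dvdn_leq (dvdn_gcdl _ _); lia.
  have phif : phi \in fam xpredT.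
    apply/pfamilyP; split.
      by apply/fintype.subsetP => p; apply: contraR => pu; rewrite ffunE ifN.
    by move=> p pu; rewrite inE phiE // dvdn_gcdr.
  rewrite (bigD1 phi) /=; last first.
    rewrite phif /=; apply: (big_ind (fun k => k %| n.-1)%N).
    - exact: dvd1n.
    - by move=> x y xn yn; rewrite dvdn_lcm xn.
    - by move=> p pu; rewrite phiE // dvdn_gcdl.
  have -> : (fermat_weight n u)%:R = wt phi.
    rewrite /fermat_weight prod_primesE natr_prod /wt.
    by apply: eq_bigr => p pu; rewrite phiE.
  by rewrite lerDl sumr_ge0.
rewrite (exchange_big_dep (fun f => f \in fam xpredT)) /=; last by move=> n f _ /andP[].
apply: (@le_trans _ _ (\sum_(f in fam xpredT) wt f *
   (1 + (if (wlcm f <= N)%N then N%:R / (u%:R * (wlcm f)%:R) else 0)))).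
  apply: ler_sum => f ff; rewrite -[leLHS](eq_bigr _ (fun i _ => mulr1 (wt f))).
  rewrite -mulr_sumr ler_wpM2l //.
  apply: le_trans (count_crt_le N u0 (wlcm_gt0 f ff)).
  by rewrite le_eqVlt; apply/orP; left; apply/eqP; apply: eq_bigl => n; rewrite ff -andbA.
under [leLHS]eq_bigr do rewrite mulrDr mulr1.
rewrite big_split /= prod_divisor_sumE lerD2l.
under [X in _ <= _ * X]eq_bigr do rewrite prod_divisor_sumE mulr_sumr.
rewrite (exchange_big_dep (fun f => f \in fam xpredT)) /=; last first.
  move=> W f _ /pfamilyP[h1 h2]; apply/pfamilyP; split=> // p pu.
  by have := h2 p pu; rewrite !inE andbT => /andP[].
rewrite mulr_sumr; apply: ler_sum => f ff.
case: ifP => wN; last by rewrite mulr0 mulr_ge0 ?sumr_ge0 // => W _; rewrite mulr_ge0 ?invr_ge0.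
have fW : f \in fam (fun h => h %| wlcm f)%N.
  have /pfamilyP[h1 h2] := ff.
  apply/pfamilyP; split=> // p pu.
  have := h2 p pu; rewrite !inE andbT => -> /=.
  by rewrite /wlcm (bigD1 p) //= dvdn_lcml.
rewrite big_mkcond /= (bigD1_seq (wlcm f)) ?iota_uniq //=; last first.
  by rewrite mem_index_iota ltnS wN wlcm_gt0.
rewrite fW mulrDr; apply: (@le_trans _ _ (N%:R / u%:R * ((wlcm f)%:R^-1 * wt f))).
  by rewrite invfM le_eqVlt; apply/orP; left; apply/eqP; ring.
rewrite lerDl mulr_ge0 ?divr_ge0 // sumr_ge0 // => W _; case: ifP => // _.
by rewrite mulr_ge0 ?invr_ge0.
Qed.

End TupleExpansion.

End Counting.

(** * Covering the composite integers by prime factors and divisors *)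

Section Covering.
Variable R : realType.
Implicit Types (N n u w : nat) (D T : R).

Lemma le_sum_term N (P : pred nat) (f : nat -> R) u :
  (1 <= u <= N)%N -> P u -> (forall x, 0 <= f x) ->
  f u <= \sum_(1 <= x < N.+1 | P x) f x.
Proof.
move=> uN Pu f0; rewrite (big_rem u) /=; last by rewrite mem_index_iota ltnS.
by rewrite Pu lerDl sumr_ge0.
Qed.

Lemma fermat_weight_le n : (0 < n)%N -> (fermat_weight n n <= n)%N.
Proof.
move=> n0; have := fermat_weight_split n0 (dvd1n n).
by rewrite muln1 {2}/fermat_weight big_nil mul1n.
Qed.

Lemma fermat_weight_divisor_le N n u : (0 < n <= N)%N -> (u %| n)%N ->
  (fermat_weight n n)%:R <= (fermat_weight n u)%:R * (N%:R / u%:R) :> R.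
Proof.
move=> /andP[n0 nN] un; have u0 := dvdn_gt0 n0 un.
rewrite mulrA ler_pdivlMr ?ltr0n // -!natrM ler_nat.
by apply: leq_trans (fermat_weight_split n0 un) _; rewrite leq_mul2l nN orbT.
Qed.

Lemma smooth_divisor n D T : (0 < n)%N -> 1 <= D -> D < n%:R ->
  (forall p, prime p -> (p %| n)%N -> p%:R <= T) ->
  exists2 u, (u %| n)%N & D < u%:R <= D * T.
Proof.
move=> n0 D1 Dn nT.
have ex : exists u, (u %| n)%N && (D < u%:R) by exists n; rewrite dvdnn.
case: (ex_minnP ex) => u /andP[un Du] umin; exists u => //; rewrite Du /=.
have u0 := dvdn_gt0 n0 un.
have u1 : (1 < u)%N by rewrite -(ltr1n R) (le_lt_trans D1).
pose p := pdiv u; have pp : prime p := pdiv_prime u1.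
have pu : (p %| u)%N := pdiv_dvd u.
have vD : (u %/ p)%N%:R <= D.
  rewrite leNgt; apply/negP => Dv.
  have vu : (u %/ p %| u)%N by rewrite -[X in (_ %| X)%N](divnK pu) dvdn_mulr.
  have := umin (u %/ p)%N; rewrite Dv andbT (dvdn_trans vu un).
  by move/(_ isT); rewrite leqNgt ltn_Pdiv // prime_gt1.
rewrite -(divnK pu) natrM ler_pM //.
by apply: nT => //; apply: dvdn_trans un.
Qed.

(** [X] and [Y] majorise the weight of an [n] with a prime factor beyond [T], respectively with a
    divisor in the window. Summing over all candidates avoids selecting one and allows the exchange
    with the sum over [n]. *)
Let X N T n := \sum_(1 <= p < N.+1 | [&& prime p, T < p%:R & (p %| n)%N])
  (gcdn n.-1 p.-1)%:R * (N%:R / p%:R) : R.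
Let Y N D T n := \sum_(1 <= u < N.+1 | (D < u%:R <= D * T) && (u %| n)%N)
  (fermat_weight n u)%:R * (N%:R / u%:R) : R.

Let pointwise N D T n : 1 <= D -> (1 < n <= N)%N ->
  (fermat_weight n n)%:R <= D + X N T n + Y N D T n.
Proof.
move=> D1 /andP[n1 nN]; have n0 := ltnW n1.
have X0 : 0 <= X N T n by rewrite sumr_ge0 // => p _; rewrite mulr_ge0 ?divr_ge0.
have Y0 : 0 <= Y N D T n by rewrite sumr_ge0 // => p _; rewrite mulr_ge0 ?divr_ge0.
have [nD|Dn] := leP n%:R D.
  have : (fermat_weight n n)%:R <= n%:R :> R by rewrite ler_nat fermat_weight_le.
  lra.
have [[p [pp pT pn]]|noP] := pselect (exists p, [/\ prime p, T < p%:R & (p %| n)%N]).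
  have : (fermat_weight n n)%:R <= X N T n.
    apply: le_trans (@fermat_weight_divisor_le N n p _ pn) _; first by rewrite n0.
    rewrite /fermat_weight primes_prime // big_seq1 /X.
    apply: (@le_sum_term N _ (fun p => (gcdn n.-1 p.-1)%:R * (N%:R / p%:R)) p).
    - by rewrite prime_gt0 //= (leq_trans _ nN) // dvdn_leq.
    - by rewrite pp pT.
    - by move=> x; rewrite mulr_ge0 ?divr_ge0.
  lra.
have [|u un uD] := @smooth_divisor n D T n0 D1 Dn.
  by move=> p pp pn; rewrite leNgt; apply/negP => pT; apply: noP; exists p.
have : (fermat_weight n n)%:R <= Y N D T n.
  apply: le_trans (@fermat_weight_divisor_le N n u _ un) _; first by rewrite n0.
  apply: (@le_sum_term N _ (fun u => (fermat_weight n u)%:R * (N%:R / u%:R)) u).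
  - by rewrite (dvdn_gt0 n0) //= (leq_trans _ nN) // dvdn_leq.
  - by rewrite uD.
  - by move=> x; rewrite mulr_ge0 ?divr_ge0.
lra.
Qed.

(** The gcd is bounded by the sum of all common divisors [h]. The count of [n] cancels [h] and
    leaves [N^2 / p^2], at most [N^2 / (T * (p - 1))]; writing [p - 1 = h m] produces two harmonic
    sums. *)
Let sumX N T : 0 < T ->
  \sum_(1 <= n < N.+1 | composite n) X N T n <=
  N%:R ^+ 2 / T * (\sum_(1 <= h < N.+1) (h%:R : R)^-1) ^+ 2.
Proof.
move=> T0.
have hp p : 0 <= (p%:R : R)^-1 by rewrite invr_ge0.
rewrite /X (exchange_big_dep (fun p => prime p && (T < p%:R))) /=; last first.
  by move=> n p _ /and3P[-> ->].
apply: (@le_trans _ _ (\sum_(1 <= p < N.+1 | prime p && (T < p%:R))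
   \sum_(1 <= h < N.+1 | (h %| p.-1)%N) (N%:R ^+ 2 / T * (p.-1%:R : R)^-1))).
  rewrite big_nat_cond [leRHS]big_nat_cond.
  apply: ler_sum => p /andP[/andP[p1 pN] /andP[pp pT]].
  have p1' := prime_gt1 pp.
  apply: (@le_trans _ _ (\sum_(1 <= n < N.+1 | [&& composite n & (p %| n)%N])
     \sum_(1 <= h < N.+1 | (h %| p.-1)%N && (h %| n.-1)%N) h%:R * (N%:R / p%:R))).
    rewrite pp pT /= big_nat_cond [leRHS]big_nat_cond.
    apply: ler_sum => n /andP[/andP[n1 nN] /andP[/andP[n2 _] pn]].
    apply: (@le_sum_term N _ (fun h => h%:R * (N%:R / p%:R)) (gcdn n.-1 p.-1)).
    - rewrite gcdn_gt0; apply/andP; split; first by lia.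
      by apply: (@leq_trans p.-1); [apply: dvdn_leq (dvdn_gcdr _ _) | ]; lia.
    - by rewrite dvdn_gcdl dvdn_gcdr.
    - by move=> x; rewrite mulr_ge0 ?divr_ge0.
  rewrite (exchange_big_dep (fun h => (h %| p.-1)%N)) /=; last by move=> n h _ /andP[].
  rewrite big_nat_cond [leRHS]big_nat_cond.
  apply: ler_sum => h /andP[/andP[h1 hN] hp1].
  rewrite (eq_bigl (fun n => [&& composite n, (p %| n)%N & (h %| n.-1)%N])); last first.
    by move=> n; rewrite hp1 /= -andbA.
  rewrite -[leLHS](eq_bigr _ (fun i _ => mulr1 _)) -mulr_sumr.
  have h0 : 0 < (h%:R : R) by rewrite ltr0n.
  have p0 : 0 < (p%:R : R) by rewrite ltr0n prime_gt0.
  have q0 : 0 < (p.-1%:R : R) by rewrite ltr0n; lia.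
  have qp : (p.-1%:R : R) <= p%:R by rewrite ler_nat; lia.
  apply: (@le_trans _ _ (h%:R * (N%:R / p%:R) * (N%:R / (p%:R * h%:R)))).
    by rewrite ler_wpM2l ?mulr_ge0 ?divr_ge0 ?count_prime_crt_le.
  have -> : h%:R * (N%:R / p%:R) * (N%:R / (p%:R * h%:R)) = N%:R ^+ 2 * (p%:R^-1 * p%:R^-1) :> R.
    by field; rewrite !gt_eqF.
  rewrite -mulrA ler_wpM2l ?exprn_ge0 // ler_pM // lef_pV2 ?posrE // ltW //.
rewrite (exchange_big_dep xpredT) //=.
rewrite [(\sum_(_ <= _ < _) _) ^+ 2]expr2 mulr_suml mulr_sumr big_nat [leRHS]big_nat.
apply: ler_sum => h /andP[h1 hN].
rewrite -mulr_sumr ler_wpM2l //; first by rewrite divr_ge0 ?exprn_ge0 // ltW.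
apply: (@le_trans _ _ (\sum_(1 <= m < N.+1 | true && (h %| m)%N) (m%:R : R)^-1)).
  apply: (@ler_sum_nat_inj _ _ _ _ _ predn) => //.
  - by move=> p pN /andP[/andP[pp _] ->]; rewrite andbT; have := prime_gt1 pp; lia.
  - move=> p q /andP[/andP[pp _] _] /andP[/andP[qq _] _] _ _ e.
    by rewrite -(prednK (prime_gt0 pp)) e prednK ?prime_gt0.
apply: le_trans (sum_multiples_le _ _ h1 hp) _.
by under eq_bigr do rewrite natrM invfM; rewrite -mulr_sumr.
Qed.

(** Of the two constraints on [u], the error terms keep [u <= D * T] and the main terms keep
    [D < u]: each is the one its Rankin bound exploits. *)
Let sumY N D T :
  \sum_(1 <= n < N.+1 | composite n) Y N D T n <=
  N%:R * (\sum_(1 <= u < N.+1 | u%:R <= D * T) u%:R^-1 *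
    \prod_(p <- primes u) (\sum_(1 <= h < N.+1 | (h %| p.-1)%N && true) (h%:R : R))) +
  N%:R ^+ 2 * (\sum_(1 <= W < N.+1) W%:R^-1 * \sum_(1 <= u < N.+1 | D < u%:R) u%:R ^- 2 *
    \prod_(p <- primes u) (\sum_(1 <= h < N.+1 | (h %| p.-1)%N && (h %| W)%N) (h%:R : R))).
Proof.
pose G (H : pred nat) u : R :=
  \prod_(p <- primes u) (\sum_(1 <= h < N.+1 | (h %| p.-1)%N && H h) (h%:R : R)).
have G0 H u : 0 <= G H u by rewrite prodr_ge0 // => p _; rewrite sumr_ge0.
rewrite /Y (exchange_big_dep (fun u => D < u%:R <= D * T)) /=; last first.
  by move=> n u _ /andP[].
apply: (@le_trans _ _ (\sum_(1 <= u < N.+1 | D < u%:R <= D * T)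
    (N%:R * (u%:R^-1 * G xpredT u) + N%:R ^+ 2 * (u%:R ^- 2 *
      \sum_(1 <= W < N.+1) W%:R^-1 * G (fun h => h %| W)%N u)))).
  rewrite big_nat_cond [leRHS]big_nat_cond.
  apply: ler_sum => u /andP[/andP[u1 uN] uD]; rewrite ltnS in uN.
  have u0 : 0 < (u%:R : R) by rewrite ltr0n.
  rewrite -mulr_suml.
  apply: (@le_trans _ _ ((G xpredT u + N%:R / u%:R * \sum_(1 <= W < N.+1) W%:R^-1 * G (fun h => h %| W)%N u)
      * (N%:R / u%:R))).
    rewrite ler_wpM2r ?divr_ge0 //.
    apply: le_trans (sum_fermat_weight_le R u1 uN).
    rewrite big_mkcond [leRHS]big_mkcond /=; apply: ler_sum => n _.
    by rewrite uD /composite; case: ltnP; case: prime; case: (u %| n)%N.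
  by rewrite le_eqVlt; apply/orP; left; apply/eqP; field; rewrite gt_eqF.
rewrite big_split /= -!mulr_sumr lerD // ler_wpM2l ?exprn_ge0 //.
  rewrite big_mkcond [leRHS]big_mkcond /=; apply: ler_sum => u _.
  case: (D < _) => //=; case: ifP => // _; apply: mulr_ge0; [by rewrite invr_ge0 | exact: G0].
under [leLHS]eq_bigr do rewrite mulr_sumr.
rewrite [leLHS](exchange_big_dep xpredT) //=; apply: ler_sum => W _.
rewrite mulr_sumr big_mkcond [leRHS]big_mkcond /=; apply: ler_sum => u _.
have g0 : 0 <= (u%:R : R) ^- 2 by rewrite invr_ge0 exprn_ge0.
case: (D < _) => //=; case: ifP => // _; first by rewrite mulrCA.
by apply: mulr_ge0; [rewrite invr_ge0 | apply: mulr_ge0 => //; exact: G0].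
Qed.

Lemma sum_fermat_weight_composite_le N D T : 1 <= D -> 1 <= T ->
  \sum_(1 <= n < N.+1 | composite n) (fermat_weight n n)%:R <=
  N%:R * D + N%:R ^+ 2 / T * (\sum_(1 <= h < N.+1) (h%:R : R)^-1) ^+ 2 +
  (N%:R * (\sum_(1 <= u < N.+1 | u%:R <= D * T) u%:R^-1 *
    \prod_(p <- primes u) (\sum_(1 <= h < N.+1 | (h %| p.-1)%N && true) (h%:R : R))) +
  N%:R ^+ 2 * (\sum_(1 <= W < N.+1) W%:R^-1 * \sum_(1 <= u < N.+1 | D < u%:R) u%:R ^- 2 *
    \prod_(p <- primes u) (\sum_(1 <= h < N.+1 | (h %| p.-1)%N && (h %| W)%N) (h%:R : R)))).
Proof.
move=> D1 T1.
apply: (@le_trans _ _ (\sum_(1 <= n < N.+1 | composite n) (D + X N T n + Y N D T n))).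
  rewrite big_nat_cond [leRHS]big_nat_cond.
  apply: ler_sum => n /andP[/andP[_ nN] /andP[n1 _]].
  by apply: pointwise => //; rewrite n1.
rewrite !big_split /=; apply: lerD (sumY _ _ _).
apply: lerD; last by apply: sumX; lra.
rewrite big_mkcond /= (@le_trans _ _ (\sum_(1 <= n < N.+1) D)) //.
  by apply: ler_sum => n _; case: ifP => // _; lra.
by rewrite sumr_const_nat subSS subn0 mulr_natl.
Qed.

End Covering.

(** * Rankin's method and the asymptotics *)

Section Rankin.
Variable R : realType.
Implicit Types (N W : nat) (D V c eta : R).

(** For [u <= V], [u^-1 <= V^(1+eta) * u^-(2+eta)]. With all [h] allowed, the exponent [2 + eta]
    makes the remaining sum of [h^-(1+eta)] bounded by [1 + eta^-1]. *)
Lemma rankin_small_le N V eta : 0 < V -> 0 < eta ->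
  \sum_(1 <= u < N.+1 | u%:R <= V) u%:R^-1 *
    \prod_(p <- primes u) (\sum_(1 <= h < N.+1 | (h %| p.-1)%N && true) (h%:R : R)) <=
  V `^ (1 + eta) * expR (4 * (1 + eta^-1)).
Proof.
move=> V0 e0; pose G u : R :=
  \prod_(p <- primes u) (\sum_(1 <= h < N.+1 | (h %| p.-1)%N && true) (h%:R : R)).
have G0 u : 0 <= G u by apply: prodr_ge0 => p _; rewrite sumr_ge0.
have s1 : 1 < 2 + eta by lra.
have := @sum_divisor_weights_le R xpredT (2 + eta) N s1.
have := @zeta_partial_le R (1 + eta) N (_ : 1 < 1 + eta).
have -> : 2 + eta - 1 = 1 + eta by ring.
have -> : 1 + eta - 1 = eta by ring.
move=> /(_ _) hz hw.
apply: (@le_trans _ _ (V `^ (1 + eta) * \sum_(1 <= u < N.+1) u%:R `^ (- (2 + eta)) * G u)).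
  rewrite mulr_sumr big_nat_cond [leRHS]big_nat [leLHS]big_mkcond [leRHS]big_mkcond.
  apply: ler_sum => u _; rewrite /= -/(G u).
  case: (boolP (1 <= u < N.+1)%N) => //= /andP[u1 uN].
  have u0 : 0 < (u%:R : R) by rewrite ltr0n.
  case: ifP => uV; last by rewrite !mulr_ge0 ?powR_ge0.
  rewrite mulrA ler_wpM2r //.
  have -> : (u%:R : R)^-1 = u%:R `^ (1 + eta) * u%:R `^ (- (2 + eta)).
    rewrite -(powR_inv1 (ltW u0)) -powRD; last by rewrite (gt_eqF u0) implybT.
    by congr powR; ring.
  rewrite ler_wpM2r ?powR_ge0 //; by apply: ge0_ler_powR; rewrite ?nnegrE ?(ltW V0) ?(ltW u0) //; lra.
rewrite ler_wpM2l ?powR_ge0 //; apply: le_trans hw _.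
rewrite ler_expR.
have {}hz := hz ltac:(lra).
have v0 : 0 < (1 + eta)^-1 by rewrite invr_gt0; lra.
have v1 : (1 + eta)^-1 <= 1 by rewrite invf_le1; lra.
have w0 : 0 < eta^-1 by rewrite invr_gt0.
apply: (@le_trans _ _ (2 * (1 + (1 + eta)^-1) * (1 + eta^-1))); last by nra.
by rewrite ler_wpM2l //; lra.
Qed.

(** For [u > D], [u^-2 <= D^-(1-c) * u^-(1+c)]. The [6] bounds [2 * (1 + c^-1)] for [c >= 1/2]; the
    inner exponential bounds the sum of [h^-c] over the divisors of [W]. *)
Lemma rankin_large_le N W D c : 0 < D -> 2^-1 <= c <= 1 -> (0 < W)%N ->
  \sum_(1 <= u < N.+1 | D < u%:R) u%:R ^- 2 *
    \prod_(p <- primes u) (\sum_(1 <= h < N.+1 | (h %| p.-1)%N && (h %| W)%N) (h%:R : R)) <=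
  D `^ (- (1 - c)) * expR (6 * expR (4 * \sum_(q <- primes W) (q%:R : R) `^ (- c))).
Proof.
move=> D0 /andP[c2 c1] W0; pose G u : R :=
  \prod_(p <- primes u) (\sum_(1 <= h < N.+1 | (h %| p.-1)%N && (h %| W)%N) (h%:R : R)).
have G0 u : 0 <= G u by apply: prodr_ge0 => p _; rewrite sumr_ge0.
have s1 : 1 < 1 + c by lra.
have := @sum_divisor_weights_le R (fun h => h %| W)%N (1 + c) N s1.
have -> : 1 + c - 1 = c by ring.
move=> hw; have hd := sum_divisors_powR_le N c2 W0.
apply: (@le_trans _ _ (D `^ (- (1 - c)) * \sum_(1 <= u < N.+1) u%:R `^ (- (1 + c)) * G u)).
  rewrite mulr_sumr big_nat_cond [leRHS]big_nat [leLHS]big_mkcond [leRHS]big_mkcond.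
  apply: ler_sum => u _; rewrite /= -/(G u).
  case: (boolP (1 <= u < N.+1)%N) => //= /andP[u1 uN].
  have u0 : 0 < (u%:R : R) by rewrite ltr0n.
  case: ifP => uV; last by rewrite !mulr_ge0 ?powR_ge0.
  rewrite mulrA ler_wpM2r //.
  have -> : (u%:R : R) ^- 2 = u%:R `^ (- (1 - c)) * u%:R `^ (- (1 + c)).
    rewrite -powR_mulrn ?ltW // -powRN -powRD; last by rewrite (gt_eqF u0) implybT.
    by congr powR; ring.
  by rewrite ler_wpM2r ?powR_ge0 //; apply: powRN_antitone => //; [lra|exact: ltW].
rewrite ler_wpM2l ?powR_ge0 //; apply: le_trans hw _.
rewrite ler_expR.
have v0 : 0 < c^-1 by rewrite invr_gt0; lra.
have v1 : c^-1 <= 2 by rewrite invf_ple ?posrE //; lra.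
apply: ler_pM => //; last lra.
- by rewrite mulr_ge0 //; lra.
- by rewrite sumr_ge0 // => h _; exact: powR_ge0.
Qed.

End Rankin.

(** * Choice of the parameters *)

Section Asymptotics.
Variables (R : realType) (del z : R).
Hypotheses (del0 : 0 < del) (del1 : del <= 1) (zK : 4000 <= del ^+ 2 * z).

(* z, b and a stand for log log log x, log log x and log x, and Lam is log L(x). *)
Let b := expR z.
Let a := expR b.
Let x := expR a.
(** The square root of [log x]: a threshold for prime factors in [size_primes_asym], and the target
    for the inner exponential of [rankin_large_le]. *)
Let E := expR (b / 2).
Let Lam := a * z / b.

Let z_gt0 : 0 < z.
Proof.
have h : 0 < del ^+ 2 * z by apply: (lt_le_trans _ zK); lra.
by move: h; rewrite pmulr_rgt0 // exprn_gt0.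
Qed.

Let dz : 4000 <= del * z.
Proof.
apply: le_trans zK _; rewrite expr2 -mulrA ler_piMl // mulr_ge0 //; exact: ltW.
Qed.

Let z0 : 4000 <= z.
Proof. by apply: le_trans dz _; rewrite ler_piMl // ltW. Qed.

Lemma expR_ge_sqr (t : R) : 0 <= t -> t ^+ 2 / 2 <= expR t.
Proof.
move=> t0; have := @expR_ge1Dxn R t 1 t0.
by rewrite -[2`!]/2%N => h; apply: le_trans h; rewrite lerDr.
Qed.

Lemma expR_ge_cube (t : R) : 0 <= t -> t ^+ 3 / 6 <= expR t.
Proof.
move=> t0; have := @expR_ge1Dxn R t 2 t0.
by rewrite -[3`!]/6%N => h; apply: le_trans h; rewrite lerDr.
Qed.

Let b_ge : 1000 * z <= b.
Proof.
have := expR_ge_sqr (ltW z_gt0); rewrite -/b; have := z0; nra.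
Qed.

Let b_big : 1000 <= b. Proof. have := b_ge; have := z0; lra. Qed.
Let b0 : 0 < b. Proof. exact: expR_gt0. Qed.
Let a0 : 0 < a. Proof. exact: expR_gt0. Qed.
Let E0 : 0 < E. Proof. exact: expR_gt0. Qed.

Let aE : a = E ^+ 2.
Proof. by rewrite /a /E expr2 -expRD; congr expR; lra. Qed.

Let E_ge : b * 100 <= E.
Proof.
have bb := b_big.
have := @expR_ge_sqr (b / 2) ltac:(lra).
rewrite -/E => h; apply: le_trans h; nra.
Qed.

Let ab_ge : b ^+ 2 / 6 <= a / b.
Proof.
rewrite ler_pdivlMr //; have := @expR_ge_cube b (ltW b0); rewrite -/a.
by apply: le_trans; rewrite le_eqVlt; apply/orP; left; apply/eqP; field.
Qed.

Let LamE : del * Lam = del * z * (a / b).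
Proof. by rewrite /Lam; field; rewrite gt_eqF. Qed.

Let Lam0 : 0 < Lam.
Proof. by rewrite /Lam divr_gt0 // mulr_gt0 //; have := z0; lra. Qed.

Let Lam_b : 100 * b ^+ 2 <= del * Lam.
Proof.
rewrite LamE; have := ab_ge; have := sqr_ge0 b => h1 h2.
apply: (@le_trans _ _ (4000 * (a / b))); first by move: h1 h2; move: (a / b) (b ^+ 2) => u v; lra.
by rewrite ler_wpM2r // divr_ge0 // ltW.
Qed.

Let Lam_E : 100 * E <= del * Lam.
Proof.
rewrite LamE aE expr2.
have h : 100 <= E / b by rewrite ler_pdivlMr // mulrC; exact: E_ge.
have h2 : 100 <= del * z * (E / b).
  have := dz; move: h; move: (E / b) (del * z) => u v; nra.
have -> : E * E / b = E * (E / b) by rewrite mulrA.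
by rewrite [E * _]mulrC !mulrA ler_wpM2r ?(ltW E0) // -mulrA.
Qed.

Let Lam_ab : 100 * (a / b) <= del * Lam.
Proof. by rewrite LamE ler_wpM2r ?divr_ge0 ?ltW //; apply: lt_le_trans dz; lra. Qed.

Let Lam_a : Lam * 1000 <= a.
Proof.
have := b_ge; rewrite /Lam mulrAC ler_pdivrMr // => h.
by rewrite -mulrA ler_wpM2l ?(ltW a0) // mulrC.
Qed.

Let zb : 2 * (z / b) <= del.
Proof.
have := expR_ge_sqr (ltW z_gt0); rewrite -/b => h.
rewrite mulrA ler_pdivrMr //; have : del * (z ^+ 2 / 2) <= del * b by rewrite ler_wpM2l // ltW.
have := dz; have := z0; nra.
Qed.

(** Splitting the primes at [E] bounds their number by [E + 2 * (a / b)], whereas [Lam] is [a / b]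
    times the large factor [z]. Hence [4^omega(n)] is absorbed by [L(x)^del]. *)
Lemma size_primes_asym n : (0 < n)%N -> (n%:R : R) <= x ->
  ((4 ^ size (primes n))%N%:R : R) <= expR (del * Lam).
Proof.
move=> n0 nx.
have E1 : 1 < E by have := E_ge; have := b_big; lra.
have lnE : ln E = b / 2 by rewrite /E expRK.
have lnn : ln (n%:R : R) <= a by rewrite -[leRHS]expRK ler_ln ?posrE ?ltr0n ?expR_gt0.
have h : (size (primes n))%:R <= E + 2 * (a / b).
  apply: le_trans (size_primes_le E1 n0) _; rewrite lerD2l lnE.
  apply: (@le_trans _ _ (a / (b / 2))).
    by rewrite ler_wpM2r // invr_ge0 divr_ge0 // ltW.
  by rewrite le_eqVlt; apply/orP; left; apply/eqP; field; rewrite gt_eqF.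
rewrite natrX; have e4 : (4%:R : R) <= expR 3 by have := expR_ge1Dx (3 : R); lra.
apply: (@le_trans _ _ (expR 3 ^+ size (primes n))).
  by rewrite lerXn2r ?nnegrE ?expR_ge0.
rewrite -expRM_natl ler_expR; have := Lam_E; have := Lam_ab; move: h.
have := divr_gt0 a0 b0; have := E0.
by move: (a / b) (del * Lam) E (size _)%:R => u v e k; lra.
Qed.

(* With this exponent, a^(1-c) = b^(1-del) is smaller than log log x while
   x^(1-c) is still L(x)^(1-del). *)
Let c := 1 - (1 - del) * (z / b).

Let c_bounds : 2^-1 <= c <= 1.
Proof.
have z00 := z0; have h0 : 0 <= z / b by rewrite divr_ge0 ?(ltW b0) //; lra.
rewrite /c; have := zb; move: h0 del0 del1; move: (z / b) del => u v; nra.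
Qed.

(** Splitting at [y = log x] bounds the sum by [b^(1-del)] times a linear function of [z], and
    [b^del = expR (del * z)] outgrows that function. The target [b / 2] makes the exponential in
    [rankin_large_le] at most [E]. *)
Let prime_sum_asym W : (0 < W)%N -> (W%:R : R) <= x ->
  4 * \sum_(q <- primes W) (q%:R : R) `^ (- c) <= b / 2.
Proof.
move=> W0 Wx; have /andP[c2 c1] := c_bounds.
have a1 : 1 < a by rewrite -expR0 ltr_expR.
have lna : ln a = b by rewrite expRK.
have h := @sum_primes_powR_le R c a W _ a1 W0; rewrite lna in h.
have {}h := h ltac:(lra).
have lnW : ln (W%:R : R) <= a by rewrite -[leRHS]expRK ler_ln ?posrE ?ltr0n ?expR_gt0.
have ac : a `^ (1 - c) = expR ((1 - del) * z).
  by rewrite powR_expln // lna /c; congr expR; field; rewrite gt_eqF.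
have aac : a * a `^ (- c) = a `^ (1 - c).
  rewrite -{1}(powRr1 (ltW a0)) -powRD //; by rewrite (gt_eqF a0) implybT.
have h2 : ln (W%:R : R) / b * a `^ (- c) <= expR ((1 - del) * z).
  rewrite -ac -aac ler_wpM2r ?powR_ge0 // ler_pdivrMr //.
  apply: le_trans lnW _; rewrite ler_peMr ?(ltW a0) //; have := b_big; lra.
have lnb : ln (1 + 2 * b) <= 2 * z.
  have -> : 2 * z = ln (b ^+ 2) by rewrite lnXn // expRK mulr_natl.
  have bb := b_big; rewrite ler_ln ?posrE; [nra|lra|nra].
have e0 : 0 < expR ((1 - del) * z) by exact: expR_gt0.
have bE : b = expR ((1 - del) * z) * expR (del * z) by rewrite -expRD /b; congr expR; ring.
(* Here the hypothesis on [del ^+ 2 * z] is used in full: [(del * z)^2 / 2 >= 2000 * z]. *)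
have edz : 500 * z <= expR (del * z).
  have dz' := dz.
  have := @expR_ge_sqr (del * z) ltac:(lra); apply: le_trans.
  rewrite exprMn; have := zK; have := z0; move: (del ^+ 2) => u; nra.
move: h h2 lnb e0 bE edz z0; rewrite ac.
set A := \sum_(_ <- _) _; set B := _ * _ `^ _; set e1 := expR _; set e2 := expR _.
move=> h h2 lnb e0 bE edz z00.
have h3 : A <= e1 * (5 / 2 + 2 * (2 * z)) + e1.
  apply: le_trans h _; apply: lerD h2; rewrite ler_wpM2l ?(ltW e0) //; lra.
rewrite bE; nra.
Qed.

(** Each of the four parts of [sum_fermat_weight_composite_le] costs at most [4 * del] in the
    exponent; the fifth [del] absorbs the factor [4] from adding them. *)
Lemma fermat_weight_average :
  \sum_(1 <= n < (Num.truncn x).+1 | composite n) (fermat_weight n n)%:R <=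
  x ^+ 2 * expR (- (1 - 5 * del) * Lam).
Proof.
set N := Num.truncn x.
have x0 : 0 < x by exact: expR_gt0.
have Nx : (N%:R : R) <= x by rewrite truncn_le ltW.
pose D := expR (a - 2 * Lam); pose T := expR Lam.
have D1 : 1 <= D by rewrite -expR0 ler_expR; have := Lam_a; have := Lam0; lra.
have T1 : 1 <= T by rewrite -expR0 ler_expR ltW.
have DT : D * T = expR (a - Lam) by rewrite -expRD; congr expR; ring.
have lnN : 1 + ln (N.+1%:R : R) <= 2 + a.
  suff : ln (N.+1%:R : R) <= ln (expR (1 + a)) by rewrite expRK; lra.
  rewrite ler_ln ?posrE ?ltr0n ?expR_gt0 // expRD -natr1.
  have := expR_ge1Dx (1 : R).
  have x1 : 1 <= x by rewrite -expR0 ler_expR ltW.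
  rewrite -/x; nra.
have harm : \sum_(1 <= h < N.+1) (h%:R : R)^-1 <= 2 + a by apply: le_trans (harmonic_le R N) _.
have harm0 : 0 <= \sum_(1 <= h < N.+1) (h%:R : R)^-1 by rewrite sumr_ge0.
(* [expR (2 * b)] is [(log x)^2], so even the square of a harmonic sum costs only
   [4 * b <= del * Lam]. *)
have a2 : 2 + a <= expR (2 * b).
  have -> : 2 * b = b + b by ring.
  rewrite expRD -/a; have := expR_ge1Dx b; rewrite -/a; have := b_big; nra.
have dL := Lam_b; have bb := b_big.
have b4 : 4 * b <= del * Lam by nra.
apply: le_trans (sum_fermat_weight_composite_le N D1 T1) _.
have N2 : (N%:R : R) ^+ 2 <= x ^+ 2 by rewrite lerXn2r ?nnegrE ?ler0n // ltW.
have t1 : N%:R * D <= x ^+ 2 * expR (- (1 - 4 * del) * Lam).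
  apply: (@le_trans _ _ (x * D)); first by rewrite ler_wpM2r ?expR_ge0.
  rewrite expr2 -mulrA ler_wpM2l ?(ltW x0) // /D /x -expRD ler_expR.
  have := mulr_gt0 del0 Lam0; have := Lam0; lra.
have t2 : N%:R ^+ 2 / T * (\sum_(1 <= h < N.+1) (h%:R : R)^-1) ^+ 2
    <= x ^+ 2 * expR (- (1 - 4 * del) * Lam).
  rewrite -mulrA ler_pM ?exprn_ge0 ?mulr_ge0 ?invr_ge0 ?expR_ge0 //.
  apply: (@le_trans _ _ (T^-1 * (expR (2 * b)) ^+ 2)).
    rewrite ler_wpM2l ?invr_ge0 ?expR_ge0 // lerXn2r ?nnegrE ?expR_ge0 //.
    exact: le_trans a2.
  rewrite -expRN expr2 -!expRD ler_expR.
  have := mulr_gt0 del0 Lam0; lra.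
have t3 : N%:R * (\sum_(1 <= u < N.+1 | u%:R <= D * T) u%:R^-1 *
    \prod_(p <- primes u) (\sum_(1 <= h < N.+1 | (h %| p.-1)%N && true) (h%:R : R)))
    <= x ^+ 2 * expR (- (1 - 4 * del) * Lam).
  (* Chosen so that [x^eta = L(x)^del], while [eta^-1 <= b] keeps the factor
     [expR (4 * (1 + eta^-1))] negligible. *)
  pose eta := del * (z / b).
  have zb0 : 0 < z / b by rewrite divr_gt0 //; have := z0; lra.
  have eta0 : 0 < eta by rewrite mulr_gt0.
  rewrite expr2 -mulrA ler_pM ?ler0n //.
    rewrite sumr_ge0 // => u _; rewrite mulr_ge0 ?invr_ge0 // prodr_ge0 // => p _.
    by rewrite sumr_ge0.
  apply: le_trans (rankin_small_le N _ eta0) _; first by rewrite DT expR_gt0.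
  rewrite DT powR_expln ?expR_gt0 // expRK /x -!expRD ler_expR.
  have etaV : eta^-1 <= b.
    have dz' := dz; rewrite /eta -[leRHS]invrK lef_pV2 ?posrE ?invr_gt0 //.
    by rewrite mulrA ler_peMl ?invr_ge0 ?(ltW b0) //; lra.
  have aeta : a * eta = del * Lam by rewrite /eta /Lam; field; rewrite gt_eqF.
  have : 0 <= eta * Lam by rewrite mulr_ge0 ?ltW.
  have -> : (1 + eta) * (a - Lam) = a - Lam + a * eta - eta * Lam by ring.
  have L4 : 4 + 4 * b <= del * Lam.
    by apply: le_trans dL; move: bb; move: b => u; nra.
  have -> : - (1 - 4 * del) * Lam = - Lam + 4 * (del * Lam) by ring.
  rewrite aeta; move: L4 etaV b4; move: (del * Lam) (eta * Lam) (eta^-1) => u v w; lra.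
have t4 : N%:R ^+ 2 * (\sum_(1 <= W < N.+1) W%:R^-1 * \sum_(1 <= u < N.+1 | D < u%:R) u%:R ^- 2 *
    \prod_(p <- primes u) (\sum_(1 <= h < N.+1 | (h %| p.-1)%N && (h %| W)%N) (h%:R : R)))
    <= x ^+ 2 * expR (- (1 - 4 * del) * Lam).
  rewrite ler_pM ?exprn_ge0 ?ler0n //.
    rewrite sumr_ge0 // => W _; rewrite mulr_ge0 ?invr_ge0 // sumr_ge0 // => u _.
    rewrite mulr_ge0 ?invr_ge0 ?exprn_ge0 // prodr_ge0 // => p _.
    by rewrite sumr_ge0.
  pose M := D `^ (- (1 - c)) * expR (6 * E).
  have M0 : 0 <= M by rewrite mulr_ge0 ?powR_ge0 ?expR_ge0.
  apply: (@le_trans _ _ (\sum_(1 <= W < N.+1) W%:R^-1 * M)).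
    rewrite big_nat_cond [leRHS]big_nat_cond; apply: ler_sum => W /andP[/andP[W1 WN] _].
    rewrite ler_wpM2l ?invr_ge0 //; rewrite ltnS in WN.
    apply: le_trans (rankin_large_le N (_ : 0 < D) c_bounds W1) _; first by lra.
    rewrite ler_wpM2l ?powR_ge0 // ler_expR ler_wpM2l // ler_expR.
    by apply: prime_sum_asym => //; apply: le_trans Nx; rewrite ler_nat.
  rewrite -mulr_suml; apply: (@le_trans _ _ (expR (2 * b) * M)).
    by rewrite ler_wpM2r // (le_trans harm).
  rewrite /M powR_expln ?expR_gt0 // expRK -!expRD ler_expR.
  have hE := Lam_E.
  have h1 : (1 - c) * a = (1 - del) * Lam by rewrite /c /Lam; field; rewrite gt_eqF.
  (* The price of [D = x / L(x)^2] in place of [x]: the factor [L(x)^(2 * (1 - c))] is at most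
     [L(x)^del]. *)
  have h2 : (1 - c) * (2 * Lam) <= del * Lam.
    rewrite mulrA ler_wpM2r ?(ltW Lam0) // /c.
    have z00 := z0; have h0 : 0 <= z / b by rewrite divr_ge0 ?(ltW b0) //; lra.
    have := zb; move: h0 del0 del1; move: (z / b) del => u v; nra.
  have -> : - (1 - c) * (a - 2 * Lam) = - ((1 - c) * a) + (1 - c) * (2 * Lam) by ring.
  rewrite h1; move: h2 hE b4 E0 b0; move: ((1 - c) * _) => w.
  have -> : - (1 - 4 * del) * Lam = - Lam + 4 * (del * Lam) by ring.
  have -> : (1 - del) * Lam = Lam - del * Lam by ring.
  move: (del * Lam) => v; lra.
have four : 4 <= expR (del * Lam) by have := expR_ge1Dx (del * Lam); lra.
have -> : - (1 - 5 * del) * Lam = del * Lam + - (1 - 4 * del) * Lam by ring.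
rewrite expRD [leRHS]mulrCA.
have Y0 : 0 <= x ^+ 2 * expR (- (1 - 4 * del) * Lam) by rewrite mulr_ge0 ?exprn_ge0 ?expR_ge0 // ltW.
apply: le_trans (lerD (lerD t1 t2) (lerD t3 t4)) _.
move: Y0 four; set Y := x ^+ 2 * _; move: (expR (del * Lam)) => v; nra.
Qed.

End Asymptotics.

(** * From the Fermat weight back to [Gal] *)

Lemma sum_expn_le (p d : nat) : (1 < p)%N ->
  (\sum_(j < d.+1) p ^ j <= 2 * p ^ d)%N.
Proof.
move=> p1; elim: d => [|d IH]; first by rewrite big_ord1.
rewrite big_ord_recr /= mul2n -addnn leq_add2r (leq_trans IH) //.
by rewrite expnS leq_mul2r p1 orbT.
Qed.

(** One factor [2] per prime comes from [residue_card_le], the other from the geometric sum, at most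
    [2 * p^(d-1)]; the product of the primes of [n] is at most [n]. *)
Lemma Gal_le_fermat_weight (n d : nat) (S : comUnitAlgType 'Z_n)
    (sigma : {lrmorphism S -> S}) :
  (1 < n)%N -> (0 < d)%N -> cyclic_extension d sigma ->
  (Gal sigma n <= 4 ^ size (primes n) * n ^ d.-1 * fermat_weight n n)%N.
Proof.
move=> n1 d0 ext; apply: leq_trans (Gal_le n1 d0 ext) _.
case: d d0 ext => // d _ _; rewrite [d.+1.-1]/=.
apply: (@leq_trans (\prod_(p <- primes n) (4 * p ^ d * gcdn n.-1 p.-1))%N).
  rewrite big_seq [leqRHS]big_seq; apply: leq_prod => p; rewrite mem_primes => /and3P[pp _ _].
  rewrite mulnA leq_mul2r; apply/orP; right.
  by rewrite -[4%N]/(2 * 2)%N -mulnA leq_mul2l sum_expn_le ?prime_gt1.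
rewrite !big_split /= leq_mul2r; apply/orP; right.
rewrite big_const_seq count_predT iter_muln_1 leq_mul2l; apply/orP; right.
have -> : (\prod_(p <- primes n) p ^ d = (\prod_(p <- primes n) p) ^ d)%N.
  by apply/esym; apply: (big_morph (fun x => x ^ d)%N (fun x y => expnMn x y d) (exp1n d)).
case: d => // d; rewrite leq_exp2r //; apply: dvdn_leq; first exact: ltnW.
apply: prod_primes_dvd; rewrite ?primes_uniq //; apply/allP => p.
  by rewrite mem_primes => /and3P[].
by rewrite mem_primes => /and3P[].
Qed.

(** The sixth [del] pays for [4^omega(n)]. The triple exponential threshold is the hypothesis
    [4000 <= del ^+ 2 * z] read at [z = log log log x]. *)
Lemma average_Gal_le (R : realType) (d : nat) (S : forall n : nat, comUnitAlgType 'Z_n)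
    (sigma : forall n : nat, {lrmorphism S n -> S n}) (del x : R) :
  (0 < d)%N ->
  (forall n : nat, odd_composite n -> cyclic_extension d (sigma n)) ->
  0 < del -> del <= 1 -> expR (expR (expR (4000 / del ^+ 2))) <= x ->
  let Lam := ln x * ln (ln (ln x)) / ln (ln x) in
  0 < Lam /\
  x^-1 * (\sum_(0 <= n < (Num.truncn x).+1 | odd_composite n) Gal (sigma n) n)%:R
    <= x ^+ d * expR (- (1 - 6 * del) * Lam).
Proof.
move=> d0 ext del0 del1 xK.
have d2 : 0 < del ^+ 2 by rewrite exprn_gt0.
have K0 : 0 < 4000 / del ^+ 2 by apply: divr_gt0; [lra | exact: d2].
have x0 : 0 < x by apply: lt_le_trans xK; exact: expR_gt0.
have lnx : expR (expR (4000 / del ^+ 2)) <= ln x.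
  by rewrite -[leLHS]expRK ler_ln ?posrE ?expR_gt0.
have lnx0 : 0 < ln x by apply: lt_le_trans lnx; exact: expR_gt0.
have llnx : expR (4000 / del ^+ 2) <= ln (ln x).
  by rewrite -[leLHS]expRK ler_ln ?posrE ?expR_gt0.
have llnx0 : 0 < ln (ln x) by apply: lt_le_trans llnx; exact: expR_gt0.
have zK : 4000 / del ^+ 2 <= ln (ln (ln x)).
  by rewrite -[leLHS]expRK ler_ln ?posrE ?expR_gt0.
have z0 : 0 < ln (ln (ln x)) by apply: lt_le_trans zK.
rewrite ler_pdivrMr // mulrC in zK.
have hF := fermat_weight_average del0 del1 zK.
have hw := size_primes_asym del0 del1 zK.
rewrite !lnK ?posrE // in hF hw.
set Lam := ln x * _ / _ in hF hw *; split; first by rewrite /Lam divr_gt0 // mulr_gt0.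
set N := Num.truncn x in hF *.
have Nx : (N%:R : R) <= x by rewrite truncn_le ltW.
have hG : (\sum_(0 <= n < N.+1 | odd_composite n) Gal (sigma n) n)%:R <=
    expR (del * Lam) * x ^+ d.-1 * (\sum_(1 <= n < N.+1 | composite n) (fermat_weight n n)%:R).
  rewrite natr_sum big_ltn_cond //= mulr_sumr.
  rewrite big_nat_cond [leRHS]big_nat_cond [leLHS]big_mkcond [leRHS]big_mkcond /=.
  apply: ler_sum => n _; case: (boolP (1 <= n < N.+1)%N) => //= /andP[n1 nN].
  rewrite ltnS in nN; have nx : (n%:R : R) <= x by apply: le_trans Nx; rewrite ler_nat.
  case: ifP => [on|_]; last first.
    by case: ifP => // _; rewrite !mulr_ge0 ?expR_ge0 ?exprn_ge0 // ltW.
  have /and3P[_ n2 npr] := on; rewrite /composite n2 npr /=.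
  apply: (@le_trans _ _ ((4 ^ size (primes n) * n ^ d.-1 * fermat_weight n n)%N%:R)).
    by rewrite ler_nat; apply: Gal_le_fermat_weight => //; exact: ext.
  rewrite !natrM ler_wpM2r // ler_pM //; first exact: hw.
  by rewrite natrX lerXn2r ?nnegrE // ltW.
rewrite ler_pdivrMl //; apply: le_trans hG _.
have h0 : 0 <= expR (del * Lam) * x ^+ d.-1 by rewrite mulr_ge0 ?expR_ge0 ?exprn_ge0 // ltW.
apply: le_trans (ler_wpM2l h0 hF) _.
have -> : - (1 - 6 * del) * Lam = del * Lam + - (1 - 5 * del) * Lam by ring.
have xd : x ^+ d = x * x ^+ d.-1 by rewrite -exprS prednK.
rewrite expRD xd le_eqVlt; apply/orP; left; apply/eqP; ring.
Qed.

Unset Implicit Arguments.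

Theorem theorem2 (R : realType) (d : nat) (hd : (1 <= d)%N)
    (S : forall n : nat, comUnitAlgType 'Z_n)
    (sigma : forall n : nat, {lrmorphism S n -> S n})
    (hS : forall n : nat, odd_composite n -> cyclic_extension d (sigma n)) :
  exists e : R -> R,
    e x @[x --> +oo] --> 0 /\
    \forall x \near +oo,
      x^-1 * (\sum_(0 <= n < (Num.truncn x).+1 | odd_composite n)
                 Gal (sigma n) n)%:R
        <= x ^+ d * (L x) `^ (- 1 + e x).
Proof.
pose A (x : R) := x^-1 * (\sum_(0 <= n < (Num.truncn x).+1 | odd_composite n)
                 Gal (sigma n) n)%:R.
pose Lam (x : R) := ln x * ln (ln (ln x)) / ln (ln x).
(* The exponent that gives equality, cut off at [0] from below: the average might be much smaller
   than the bound, and [e] must still tend to [0]. The case [A x = 0], where the logarithm says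
   nothing, is set apart. *)
pose e (x : R) := if A x == 0 then 0 else Num.max 0 (1 + ln (A x / x ^+ d) / Lam x).
have bound del : 0 < del -> del <= 1 -> \forall x \near +oo,
    [/\ 0 < x, 0 < Lam x & A x <= x ^+ d * expR (- (1 - 6 * del) * Lam x)].
  move=> del0 del1; have avg := fun x => @average_Gal_le R d S sigma del x hd hS del0 del1.
  move: avg; move: (expR (4000 / _)) => K avg; near=> x.
  have xK : expR (expR K) <= x by near: x; apply: nbhs_pinfty_ge; exact: num_real.
  have [l0 h] := avg x xK.
  by split=> //; apply: lt_le_trans xK; exact: expR_gt0.
exists e; split.
  apply/cvgrPdist_le => /= eps eps0.
  (* The loss is [6 * del], and [average_Gal_le] asks for [del <= 1]. *)
  pose del := Num.min 1 (eps / 6).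
  have del0 : 0 < del by rewrite lt_min ltr01 divr_gt0.
  have del1 : del <= 1 by rewrite ge_min lexx.
  have del6 : 6 * del <= eps by rewrite mulrC -ler_pdivlMr // ge_min lexx orbT.
  near=> x.
  have [x0 l0 h] : [/\ 0 < x, 0 < Lam x & A x <= x ^+ d * expR (- (1 - 6 * del) * Lam x)].
    by near: x; exact: bound.
  rewrite sub0r normrN /e; case: eqVneq => [_|A0]; first by rewrite normr0 ltW.
  have Ap : 0 < A x by rewrite lt_neqAle eq_sym A0 /A mulr_ge0 ?invr_ge0 // ltW.
  rewrite ger0_norm ?le_max ?lexx // ge_max (ltW eps0) /=.
  apply: le_trans del6; rewrite -lerBrDl ler_pdivrMr //.
  have -> : 6 * del - 1 = - (1 - 6 * del) by ring.
  rewrite -[leRHS]expRK ler_ln ?posrE ?expR_gt0 ?divr_gt0 ?exprn_gt0 //.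
  by rewrite ler_pdivrMr ?exprn_gt0 // mulrC.
near=> x.
(* The instance [del = 1] supplies the positivity of [x] and [Lam x]; the inequality then follows
   from the choice of [e]. *)
have [x0 l0 h] : [/\ 0 < x, 0 < Lam x & A x <= x ^+ d * expR (- (1 - 6 * 1) * Lam x)].
  by near: x; apply: bound.
rewrite -/(A x) /L powR_expln ?expR_gt0 // expRK -/(Lam x) /e.
case: eqVneq => [->|A0]; first by rewrite mulr_ge0 ?exprn_ge0 ?expR_ge0 // ltW.
have Ap : 0 < A x by rewrite lt_neqAle eq_sym A0 /A mulr_ge0 ?invr_ge0 // ltW.
rewrite mulrC -ler_pdivrMr ?exprn_gt0 //.
have q0 : 0 < A x / x ^+ d by rewrite divr_gt0 ?exprn_gt0.
rewrite -[leLHS]lnK ?posrE // ler_expR -ler_pdivrMr //.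
have : 1 + ln (A x / x ^+ d) / Lam x <= Num.max 0 (1 + ln (A x / x ^+ d) / Lam x).
  by rewrite le_max lexx orbT.
by lra.
Unshelve. all: by end_near.
Qed.
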